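(* $\mathsf{RCA}_0^\omega+\mathsf{IND}_1$ proves $\mathsf{ADS}_0\to\mathsf{NBI}$.
   Context: Framework: Kohlenbach's higher-order arithmetic; $\mathsf{RCA}_0^\omega$ is the base theory (ordered semiring axioms, combinators/$\lambda$-abstraction, primitive recursion $\mathbf R_0$, extensionality at all finite types, quantifier-free induction, $\mathsf{QF\text{-}AC}^{1,0}$). Reals are fast-converging Cauchy sequences of rationals with equality $=_{\mathbb R}$. A set $X\subseteq\mathbb R$ (or $X\subseteq\mathbb N^{\mathbb N}$) is given by an arbitrary characteristic function; it is countable if there is $Y$ from $\mathbb R$ (resp. $\mathbb N^{\mathbb N}$) to $\mathbb N$ injective on $X$. A linear order $(X,\preceq_X)$ consists of such a set $X$ and a binary relation $\preceq_X$ on $X$ (given by a functional) that is reflexive, antisymmetric, transitive and total on $X$; it is countable if $X$ is, and infinite if for every $n$ there are pairwise distinct $x_0,\dots,x_n\in X$. An infinite ascending (descending) sequence is $(x_n)$ in $X$ with $x_n\prec_Xx_{n+1}$ ($x_{n+1}\prec_Xx_n$) for all $n$. $\mathsf{ADS}_0$: every countable infinite linear order has an infinite ascending or descending sequence. $\mathsf{IND}_1$: induction for formulas $\varphi(n)\equiv(\exists f\in\mathbb N^{\mathbb N})(Z(f,n)=0)$ with $Z$ of type 2. $\mathsf{NBI}$: for every $Y:[0,1]\to\mathbb N$, either there are $x,y\in[0,1]$ with $x\ne_{\mathbb R}y$ and $Y(x)=Y(y)$, or there is $N$ with $(\forall x\in[0,1])(Y(x)\ne N)$. *)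

(* Defs.v *)
(* Standard library only.

   The theorem is about derivability in a formal system, so its language, its
   calculus and its axioms are defined as inductive types. *)
From Stdlib Require Import List.
Import ListNotations.

(** * Finite types, terms and formulas *)

Inductive ty : Set := Nat | Arr (σ τ : ty).

Notation "σ ⇒ τ" := (Arr σ τ) (at level 55, right associativity).

Definition ty1 : ty := Nat ⇒ Nat.
Definition ty2 : ty := ty1 ⇒ Nat.

(* The syntax is well typed and well scoped by construction: [V σ] is the set
   of free variables of type [σ], and [ext V ρ] adds one variable of type [ρ],
   the one which a quantifier over [ρ] binds. *)
Inductive ext (V : ty -> Set) (ρ : ty) : ty -> Set :=
| here : ext V ρ ρ
| there : forall σ, V σ -> ext V ρ σ.
Arguments here {V ρ}.
Arguments there {V ρ σ} v.

Inductive no_var : ty -> Set := .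

Inductive tm (V : ty -> Set) : ty -> Set :=
| t_var : forall σ, V σ -> tm V σ
| t_app : forall σ τ, tm V (σ ⇒ τ) -> tm V σ -> tm V τ
| t_zero : tm V Nat
| t_one : tm V Nat
| t_plus : tm V (Nat ⇒ Nat ⇒ Nat)
| t_times : tm V (Nat ⇒ Nat ⇒ Nat)
| t_K : forall ρ τ, tm V (ρ ⇒ τ ⇒ ρ)
| t_S : forall δ ρ τ, tm V ((δ ⇒ ρ ⇒ τ) ⇒ (δ ⇒ ρ) ⇒ δ ⇒ τ)
| t_rec : tm V ((Nat ⇒ Nat ⇒ Nat) ⇒ Nat ⇒ Nat ⇒ Nat).
Arguments t_var {V σ} v.
Arguments t_app {V σ τ} s t.
Arguments t_zero {V}.
Arguments t_one {V}.
Arguments t_plus {V}.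
Arguments t_times {V}.
Arguments t_K {V} ρ τ.
Arguments t_S {V} δ ρ τ.
Arguments t_rec {V}.

Inductive fm (V : ty -> Set) : Set :=
| f_bot : fm V
| f_eq : tm V Nat -> tm V Nat -> fm V
| f_lt : tm V Nat -> tm V Nat -> fm V
| f_imp : fm V -> fm V -> fm V
| f_and : fm V -> fm V -> fm V
| f_or : fm V -> fm V -> fm V
| f_all : forall ρ, fm (ext V ρ) -> fm V
| f_ex : forall ρ, fm (ext V ρ) -> fm V.
Arguments f_bot {V}.
Arguments f_eq {V} s t.
Arguments f_lt {V} s t.
Arguments f_imp {V} A B.
Arguments f_and {V} A B.
Arguments f_or {V} A B.
Arguments f_all {V} ρ A.
Arguments f_ex {V} ρ A.

(** * Substitution *)

Definition sub (V W : ty -> Set) : Set := forall σ, V σ -> tm W σ.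

Fixpoint tsubst {V W} (θ : sub V W) {τ} (t : tm V τ) : tm W τ :=
  match t with
  | t_var v => θ _ v
  | t_app s u => t_app (tsubst θ s) (tsubst θ u)
  | t_zero => t_zero
  | t_one => t_one
  | t_plus => t_plus
  | t_times => t_times
  | t_K ρ τ => t_K ρ τ
  | t_S δ ρ τ => t_S δ ρ τ
  | t_rec => t_rec
  end.

Definition ids {V} : sub V V := fun _ v => t_var v.

Definition wks {V ρ} : sub V (ext V ρ) := fun _ v => t_var (there v).

Definition wks2 {V ρ τ} : sub V (ext (ext V ρ) τ) :=
  fun _ v => t_var (there (there v)).

Definition shift {V ρ τ} (t : tm V τ) : tm (ext V ρ) τ := tsubst wks t.

Definition scons {V W ρ} (t : tm W ρ) (θ : sub V W) : sub (ext V ρ) W :=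
  fun σ v =>
    match v in ext _ _ σ return tm W ρ -> tm W σ with
    | here => fun t => t
    | there v => fun _ => θ _ v
    end t.

Definition up {V W ρ} (θ : sub V W) : sub (ext V ρ) (ext W ρ) :=
  scons (t_var here) (fun σ v => shift (θ σ v)).

Fixpoint fsubst {V W} (θ : sub V W) (A : fm V) : fm W :=
  match A with
  | f_bot => f_bot
  | f_eq s t => f_eq (tsubst θ s) (tsubst θ t)
  | f_lt s t => f_lt (tsubst θ s) (tsubst θ t)
  | f_imp A B => f_imp (fsubst θ A) (fsubst θ B)
  | f_and A B => f_and (fsubst θ A) (fsubst θ B)
  | f_or A B => f_or (fsubst θ A) (fsubst θ B)
  | f_all ρ A => f_all ρ (fsubst (up θ) A)
  | f_ex ρ A => f_ex ρ (fsubst (up θ) A)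
  end.

Definition inst {V ρ} (A : fm (ext V ρ)) (t : tm V ρ) : fm V :=
  fsubst (scons t ids) A.

(** * Named binders and notations *)

(* [∀ x ∈ ρ, A] and [∃ x ∈ ρ, A] let a Rocq variable [x] stand for the bound
   variable, as a term over the scope in which it is introduced; [$x] is the
   same term moved to the scope of its occurrence.  For instance
   [∀ x ∈ ρ, ∃ y ∈ τ, A $x $y] is [f_all ρ (f_ex τ (A (t_var (there here)) (t_var here)))]
   up to conversion. *)
Class Wk (V W : ty -> Set) : Set := wk : forall {σ}, tm V σ -> tm W σ.
#[export] Hint Mode Wk + + : typeclass_instances.
#[export] Instance wk_refl V : Wk V V := fun σ t => t.
#[export] Instance wk_ext V W ρ (w : Wk V W) : Wk V (ext W ρ) :=
  fun σ t => shift (w σ t).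

Definition all_named {V} ρ (A : tm (ext V ρ) ρ -> fm (ext V ρ)) : fm V :=
  f_all ρ (A (t_var here)).
Definition ex_named {V} ρ (A : tm (ext V ρ) ρ -> fm (ext V ρ)) : fm V :=
  f_ex ρ (A (t_var here)).

Declare Scope ho_scope.
Delimit Scope ho_scope with ho.
Bind Scope ho_scope with tm.
Bind Scope ho_scope with fm.

Notation "$ x" := (wk x) (at level 1, x at level 0, format "$ x") : ho_scope.
Notation "s ⋅ t" := (t_app s t) (at level 20, left associativity) : ho_scope.
Notation "0" := t_zero : ho_scope.
Notation "1" := t_one : ho_scope.
Notation "s + t" := (t_app (t_app t_plus s) t) : ho_scope.
Notation "s * t" := (t_app (t_app t_times s) t) : ho_scope.
Notation "s = t" := (f_eq s t) : ho_scope.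
Notation "s < t" := (f_lt s t) : ho_scope.
Notation "s <= t" := (f_or (f_lt s t) (f_eq s t)) : ho_scope.
Notation "⊥" := f_bot : ho_scope.
Notation "¬ A" := (f_imp A f_bot) (at level 75, right associativity) : ho_scope.
Notation "A ∧ B" := (f_and A B) (at level 80, right associativity) : ho_scope.
Notation "A ∨ B" := (f_or A B) (at level 85, right associativity) : ho_scope.
Notation "A → B" := (f_imp A B)
  (at level 99, right associativity, B at level 200) : ho_scope.
Notation "∀ x .. y ∈ ρ , A" :=
  (all_named ρ (fun x => .. (all_named ρ (fun y => A)) ..))
  (at level 200, x binder, y binder, ρ at level 60, A at level 200,
   right associativity) : ho_scope.
Notation "∃ x .. y ∈ ρ , A" :=
  (ex_named ρ (fun x => .. (ex_named ρ (fun y => A)) ..))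
  (at level 200, x binder, y binder, ρ at level 60, A at level 200,
   right associativity) : ho_scope.

Local Open Scope ho_scope.

(** * Derivability *)

Definition theory : Type := forall V, fm V -> Prop.

(* Natural deduction for classical many-sorted logic with equality at type 0.
   [T] supplies axioms, in every context of free variables. *)
Inductive prv (T : theory) : forall V, list (fm V) -> fm V -> Prop :=
| prv_ax : forall V Γ A, T V A -> prv T V Γ A
| prv_hyp : forall V Γ A, In A Γ -> prv T V Γ A
| prv_impI : forall V Γ A B, prv T V (A :: Γ) B -> prv T V Γ (A → B)
| prv_impE : forall V Γ A B, prv T V Γ (A → B) -> prv T V Γ A -> prv T V Γ B
| prv_conjI : forall V Γ A B, prv T V Γ A -> prv T V Γ B -> prv T V Γ (A ∧ B)
| prv_conjE1 : forall V Γ A B, prv T V Γ (A ∧ B) -> prv T V Γ A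
| prv_conjE2 : forall V Γ A B, prv T V Γ (A ∧ B) -> prv T V Γ B
| prv_disjI1 : forall V Γ A B, prv T V Γ A -> prv T V Γ (A ∨ B)
| prv_disjI2 : forall V Γ A B, prv T V Γ B -> prv T V Γ (A ∨ B)
| prv_disjE : forall V Γ A B C,
    prv T V Γ (A ∨ B) -> prv T V (A :: Γ) C -> prv T V (B :: Γ) C ->
    prv T V Γ C
| prv_raa : forall V Γ A, prv T V ((¬ A) :: Γ) ⊥ -> prv T V Γ A
| prv_allI : forall V Γ ρ (A : fm (ext V ρ)),
    prv T (ext V ρ) (map (fsubst wks) Γ) A -> prv T V Γ (f_all ρ A)
| prv_allE : forall V Γ ρ (A : fm (ext V ρ)) (t : tm V ρ),
    prv T V Γ (f_all ρ A) -> prv T V Γ (inst A t)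
| prv_exI : forall V Γ ρ (A : fm (ext V ρ)) (t : tm V ρ),
    prv T V Γ (inst A t) -> prv T V Γ (f_ex ρ A)
| prv_exE : forall V Γ ρ (A : fm (ext V ρ)) (C : fm V),
    prv T V Γ (f_ex ρ A) ->
    prv T (ext V ρ) (A :: map (fsubst wks) Γ) (fsubst wks C) ->
    prv T V Γ C
| prv_eqI : forall V Γ (t : tm V Nat), prv T V Γ (t = t)
| prv_eqE : forall V Γ (A : fm (ext V Nat)) (s t : tm V Nat),
    prv T V Γ (s = t) -> prv T V Γ (inst A s) -> prv T V Γ (inst A t).

Definition provable (T : theory) (A : fm no_var) : Prop := prv T no_var [] A.

Notation "T ⊢ A" := (provable T A%ho) (at level 100, A at level 200, no associativity).

Definition add_axiom (T : theory) (A : forall V, fm V) : theory :=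
  fun V B => T V B \/ B = A V :> fm V.

Notation "T ⊕ A" := (add_axiom T (fun V => A)) (at level 50, left associativity).

(** * The base theory *)

Fixpoint eqt (τ : ty) : forall {V}, tm V τ -> tm V τ -> fm V :=
  match τ with
  | Nat => fun V s t => s = t
  | σ ⇒ τ => fun V s t => ∀ z ∈ σ, eqt τ ($s ⋅ $z) ($t ⋅ $z)
  end.

Fixpoint quantifier_free {V} (A : fm V) : Prop :=
  match A with
  | f_bot | f_eq _ _ | f_lt _ _ => True
  | f_imp A B | f_and A B | f_or A B => quantifier_free A /\ quantifier_free B
  | f_all _ _ | f_ex _ _ => False
  end.

Definition ordered_semiring {V} : list (fm V) :=
  [ ∀ x y z ∈ Nat, $x + ($y + $z) = ($x + $y) + $z;
    ∀ x y ∈ Nat, $x + $y = $y + $x;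
    ∀ x ∈ Nat, $x + 0 = $x;
    ∀ x y z ∈ Nat, $x * ($y * $z) = ($x * $y) * $z;
    ∀ x y ∈ Nat, $x * $y = $y * $x;
    ∀ x ∈ Nat, $x * 1 = $x;
    ∀ x ∈ Nat, $x * 0 = 0;
    ∀ x y z ∈ Nat, $x * ($y + $z) = $x * $y + $x * $z;
    ∀ x ∈ Nat, ¬ $x < $x;
    ∀ x y z ∈ Nat, $x < $y → $y < $z → $x < $z;
    ∀ x y ∈ Nat, $x < $y ∨ $x = $y ∨ $y < $x;
    ∀ x y z ∈ Nat, $x < $y → $x + $z < $y + $z;
    ∀ x y z ∈ Nat, 0 < $z → $x < $y → $x * $z < $y * $z;
    0 < 1;
    ∀ x ∈ Nat, ¬ $x < 0 ].

Inductive RCA0w : theory :=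
| ax_semiring : forall V A, In A ordered_semiring -> RCA0w V A
| ax_K : forall V ρ τ,
    RCA0w V (∀ x ∈ ρ, ∀ y ∈ τ, eqt ρ (t_K ρ τ ⋅ $x ⋅ $y) $x)
| ax_S : forall V δ ρ τ,
    RCA0w V (∀ x ∈ δ ⇒ ρ ⇒ τ, ∀ y ∈ δ ⇒ ρ, ∀ z ∈ δ,
      eqt τ (t_S δ ρ τ ⋅ $x ⋅ $y ⋅ $z) ($x ⋅ $z ⋅ ($y ⋅ $z)))
| ax_rec_zero : forall V,
    RCA0w V (∀ f ∈ Nat ⇒ Nat ⇒ Nat, ∀ m ∈ Nat, t_rec ⋅ $f ⋅ $m ⋅ 0 = $m)
| ax_rec_succ : forall V,
    RCA0w V (∀ f ∈ Nat ⇒ Nat ⇒ Nat, ∀ m n ∈ Nat,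
      t_rec ⋅ $f ⋅ $m ⋅ ($n + 1) = $f ⋅ $n ⋅ (t_rec ⋅ $f ⋅ $m ⋅ $n))
| ax_ext : forall V ρ τ,
    RCA0w V (∀ x y ∈ ρ, ∀ φ ∈ ρ ⇒ τ,
      eqt ρ $x $y → eqt τ ($φ ⋅ $x) ($φ ⋅ $y))
| ax_qf_ind : forall V (A : fm (ext V Nat)),
    quantifier_free A ->
    RCA0w V (inst A 0
             ∧ f_all Nat (A → fsubst (scons (t_var here + 1) wks) A)
             → f_all Nat A)
(* QF-AC^{1,0}; in [A] the variable [there here] is [f] and [here] is [n]. *)
| ax_qf_ac : forall V (A : fm (ext (ext V ty1) Nat)),
    quantifier_free A ->
    RCA0w V (f_all ty1 (f_ex Nat A)
             → ∃ Y ∈ ty2, ∀ f ∈ ty1,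
                 fsubst (scons ($Y ⋅ $f) (scons $f wks2)) A).

Definition IND1 {V} : fm V :=
  ∀ Z ∈ ty1 ⇒ Nat ⇒ Nat,
    (∃ f ∈ ty1, $Z ⋅ $f ⋅ 0 = 0)
    ∧ (∀ n ∈ Nat,
         (∃ f ∈ ty1, $Z ⋅ $f ⋅ $n = 0) → (∃ f ∈ ty1, $Z ⋅ $f ⋅ ($n + 1) = 0))
    → ∀ n ∈ Nat, ∃ f ∈ ty1, $Z ⋅ $f ⋅ $n = 0.

(** * Rational and real numbers *)

Definition two {V} : tm V Nat := 1 + 1.
Definition three {V} : tm V Nat := 1 + 1 + 1.
Definition five {V} : tm V Nat := 1 + 1 + 1 + 1 + 1.

Definition pow2 {V} (n : tm V Nat) : tm V Nat :=
  t_rec ⋅ (t_K (Nat ⇒ Nat) Nat ⋅ (t_times ⋅ two)) ⋅ 1 ⋅ n.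

(* [c] codes the pair [(p, m)] under the bijective Cantor pairing
   [((p + m)^2 + 3 p + m) / 2]. *)
Definition codes_pair {V} (c p m : tm V Nat) : fm V :=
  two * c = (p + m) * (p + m) + three * p + m.

(* [c] codes the rational [(a - b) / (m + 1)].  Every natural number [c], being
   the code of a pair [(p, m)], codes exactly one such triple: [a = p / 2] and
   [b = 0] for even [p], [a = 0] and [b = (p + 1) / 2] for odd [p]. *)
Definition codes_rat {V} (c a b m : tm V Nat) : fm V :=
  ∃ p ∈ Nat,
    codes_pair $c $p $m
    ∧ (($p = two * $a ∧ $b = 0) ∨ ($p + 1 = two * $b ∧ $a = 0)).

(* The rationals coded by [q] and [r] satisfy [q ≤ r + k / 2^n], respectively
   [q < r + k / 2^n], with denominators cleared. *)
Definition rat_le {V} (q r k n : tm V Nat) : fm V :=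
  ∃ a b m a' b' m' ∈ Nat,
    codes_rat $q $a $b $m ∧ codes_rat $r $a' $b' $m'
    ∧ ($a * ($m' + 1) + $b' * ($m + 1)) * pow2 $n
      <= ($a' * ($m + 1) + $b * ($m' + 1)) * pow2 $n
         + $k * (($m + 1) * ($m' + 1)).
Definition rat_lt {V} (q r k n : tm V Nat) : fm V :=
  ∃ a b m a' b' m' ∈ Nat,
    codes_rat $q $a $b $m ∧ codes_rat $r $a' $b' $m'
    ∧ ($a * ($m' + 1) + $b' * ($m + 1)) * pow2 $n
      < ($a' * ($m + 1) + $b * ($m' + 1)) * pow2 $n
         + $k * (($m + 1) * ($m' + 1)).

(* [|x(n) - x(n + i)| < 2^(-n)] for all [n] and [i]. *)
Definition is_real {V} (x : tm V ty1) : fm V :=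
  ∀ n i ∈ Nat,
    rat_lt ($x ⋅ $n) ($x ⋅ ($n + $i)) 1 $n
    ∧ rat_lt ($x ⋅ ($n + $i)) ($x ⋅ $n) 1 $n.

(* [|x(n) - y(n)| ≤ 2^(-n + 1)] for all [n]. *)
Definition real_eq {V} (x y : tm V ty1) : fm V :=
  ∀ n ∈ Nat,
    rat_le ($x ⋅ $n) ($y ⋅ $n) two $n ∧ rat_le ($y ⋅ $n) ($x ⋅ $n) two $n.

(* [x(n) ≤ y(n) + 2^(-n + 1)] for all [n]. *)
Definition real_le {V} (x y : tm V ty1) : fm V :=
  ∀ n ∈ Nat, rat_le ($x ⋅ $n) ($y ⋅ $n) two $n.

(* Constant sequences: the rationals 0 and 1 have the codes 0 and 5. *)
Definition real_zero {V} : tm V ty1 := t_K Nat Nat ⋅ 0.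
Definition real_one {V} : tm V ty1 := t_K Nat Nat ⋅ five.

Definition in_unit_interval {V} (x : tm V ty1) : fm V :=
  is_real x ∧ real_le real_zero x ∧ real_le x real_one.

(** * Countable linear orders *)

(* The real numbers and Baire space, as type 1 objects with their equality. *)
Record space := {
  point : forall V, tm V ty1 -> fm V;
  same : forall V, tm V ty1 -> tm V ty1 -> fm V
}.
Arguments point S {V} x : rename.
Arguments same S {V} x y : rename.

Definition reals : space :=
  {| point := @is_real; same := @real_eq |}.
Definition baire : space :=
  {| point := fun V x => ¬ ⊥; same := fun V x y => eqt ty1 x y |}.

Definition maps_to_nat (S : space) {V} (Y : tm V ty2) : fm V :=
  ∀ x y ∈ ty1, point S $x → point S $y → same S $x $y → $Y ⋅ $x = $Y ⋅ $y.

Definition is_set (S : space) {V} (X : tm V ty2) : fm V :=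
  maps_to_nat S X
  ∧ ∀ x ∈ ty1, point S $x → $X ⋅ $x = 0 ∨ $X ⋅ $x = 1.

Definition mem (S : space) {V} (x : tm V ty1) (X : tm V ty2) : fm V :=
  point S x ∧ X ⋅ x = 1.

(* [L] is the characteristic functional of a binary relation on the set [X]. *)
Definition is_relation (S : space) {V} (X : tm V ty2) (L : tm V (ty1 ⇒ ty1 ⇒ Nat)) : fm V :=
  (∀ x y ∈ ty1, mem S $x $X → mem S $y $X → $L ⋅ $x ⋅ $y = 0 ∨ $L ⋅ $x ⋅ $y = 1)
  ∧ (∀ x x' y y' ∈ ty1,
       mem S $x $X → mem S $x' $X → mem S $y $X → mem S $y' $X →
       same S $x $x' → same S $y $y' → $L ⋅ $x ⋅ $y = $L ⋅ $x' ⋅ $y').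

Definition rel_le {V} (L : tm V (ty1 ⇒ ty1 ⇒ Nat)) (x y : tm V ty1) : fm V :=
  L ⋅ x ⋅ y = 1.

Definition rel_lt (S : space) {V} (L : tm V (ty1 ⇒ ty1 ⇒ Nat)) (x y : tm V ty1) : fm V :=
  rel_le L x y ∧ ¬ same S x y.

Definition linear_order (S : space) {V} (X : tm V ty2) (L : tm V (ty1 ⇒ ty1 ⇒ Nat)) : fm V :=
  is_set S X ∧ is_relation S X L
  ∧ (∀ x ∈ ty1, mem S $x $X → rel_le $L $x $x)
  ∧ (∀ x y ∈ ty1, mem S $x $X → mem S $y $X →
       rel_le $L $x $y → rel_le $L $y $x → same S $x $y)
  ∧ (∀ x y z ∈ ty1, mem S $x $X → mem S $y $X → mem S $z $X →
       rel_le $L $x $y → rel_le $L $y $z → rel_le $L $x $z)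
  ∧ (∀ x y ∈ ty1, mem S $x $X → mem S $y $X →
       rel_le $L $x $y ∨ rel_le $L $y $x).

Definition countable (S : space) {V} (X : tm V ty2) : fm V :=
  ∃ Y ∈ ty2,
    maps_to_nat S $Y
    ∧ ∀ x y ∈ ty1, mem S $x $X → mem S $y $X → $Y ⋅ $x = $Y ⋅ $y → same S $x $y.

Definition infinite (S : space) {V} (X : tm V ty2) : fm V :=
  ∀ n ∈ Nat, ∃ w ∈ Nat ⇒ ty1,
    (∀ i ∈ Nat, $i <= $n → mem S ($w ⋅ $i) $X)
    ∧ (∀ i j ∈ Nat, $i <= $n → $j <= $n → ¬ $i = $j →
         ¬ same S ($w ⋅ $i) ($w ⋅ $j)).

Definition ADS0_for (S : space) {V} : fm V :=
  ∀ X ∈ ty2, ∀ L ∈ ty1 ⇒ ty1 ⇒ Nat,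
    linear_order S $X $L → countable S $X → infinite S $X →
    ∃ s ∈ Nat ⇒ ty1,
      (∀ n ∈ Nat, mem S ($s ⋅ $n) $X)
      ∧ ((∀ n ∈ Nat, rel_lt S $L ($s ⋅ $n) ($s ⋅ ($n + 1)))
         ∨ (∀ n ∈ Nat, rel_lt S $L ($s ⋅ ($n + 1)) ($s ⋅ $n))).

(* Orders on sets of reals and orders on sets of elements of Baire space are
   both in the range of the principle. *)
Definition ADS0 {V} : fm V := ADS0_for reals ∧ ADS0_for baire.

Definition NBI {V} : fm V :=
  ∀ Y ∈ ty2,
    (∀ x y ∈ ty1, in_unit_interval $x → in_unit_interval $y →
       real_eq $x $y → $Y ⋅ $x = $Y ⋅ $y) →
    (∃ x y ∈ ty1,
       in_unit_interval $x ∧ in_unit_interval $y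
       ∧ ¬ real_eq $x $y ∧ $Y ⋅ $x = $Y ⋅ $y)
    ∨ (∃ N ∈ Nat, ∀ x ∈ ty1, in_unit_interval $x → ¬ $Y ⋅ $x = $N).

(* Main.v *)
(** By completeness it suffices to show that [ADS0] implies [NBI] in every
    extensional structure that satisfies the axioms; there one can argue in
    ordinary mathematics, as long as every function and every induction predicate
    is definable.

    Suppose that [Y] is injective and surjective from the unit interval to the
    numbers.  The injectivity makes [Y] discontinuous: it separates 0 from the
    reals with base 4 digits 0 and 3 that are not 0, which gives the functional
    deciding [forall n, f n = 0].  With it every real has a normal form that depends
    only on its value, and arithmetical predicates are decidable.  Consider the
    finite sequences of normal forms of [Y^-1(0), ..., Y^-1(n)], coded in Baire
    space and ordered by length.  They form a set, there is exactly one of each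
    length, and [IND1] together with the surjectivity of [Y] shows that every length
    occurs.  An ascending sequence yields an enumeration of all of the unit
    interval, which Cantor's diagonal argument refutes; a descending sequence does
    not exist. *)

From Stdlib Require Import List Classical ClassicalEpsilon FunctionalExtensionality
  PropExtensionality ProofIrrelevance PeanoNat Lia Cantor Eqdep_dec Ring.
Require Import Defs.
Import ListNotations.

Set Implicit Arguments.

(** * Substitution *)

(** The obstacle is choice. Surjectivity of [Y] gives a preimage of every number, but QF-AC^{1,0}
    selects numbers only, so it forms neither a sequence of preimages nor a distinguished Cauchy
    sequence among the many equal ones. Normal forms settle the latter: being the only element of
    its length is what makes a finite enumeration comparable with the others in Baire space, so that
    comparing lengths is antisymmetric and the length is injective. ADS_0 settles the former, as its
    conclusion hands over one sequence of enumerations. That a finite enumeration exists is a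
    statement with a quantifier over Baire space, beyond quantifier-free induction, hence IND_1.

    The numbers of a structure may be nonstandard. Truth may be argued classically, but every
    induction runs on a predicate whose characteristic function is an element of the structure, and
    arithmetic is rebuilt from the semiring axioms.

    Base 4 with digits 0 and 3 leaves the middle of every interval free: the two possible
    continuations stay a fixed distance away from the midpoint, so a rational comparison with an
    approximation decides a digit safely. *)

Definition comp {V W U} (θ : sub V W) (θ' : sub W U) : sub V U :=
  fun σ v => tsubst θ' (θ σ v).

Lemma sub_ext V W (θ θ' : sub V W) :
  (forall σ v, θ σ v = θ' σ v) -> θ = θ'.
Proof.
  intros H; apply functional_extensionality_dep; intros σ.
  apply functional_extensionality; intros v; apply H.
Qed.

Lemma tsubst_ids V τ (t : tm V τ) : tsubst ids t = t.
Proof. induction t; simpl; rewrite ?IHt1, ?IHt2; reflexivity. Qed.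

Lemma tsubst_comp V W U (θ : sub V W) (θ' : sub W U) τ (t : tm V τ) :
  tsubst θ' (tsubst θ t) = tsubst (comp θ θ') t.
Proof. induction t; simpl; rewrite ?IHt1, ?IHt2; reflexivity. Qed.

Lemma tsubst_scons_shift V W ρ τ (u : tm W ρ) (θ : sub V W) (t : tm V τ) :
  tsubst (scons u θ) (shift t) = tsubst θ t.
Proof. apply tsubst_comp. Qed.

Lemma tsubst_up_shift V W ρ τ (θ : sub V W) (t : tm V τ) :
  tsubst (up θ) (shift (ρ := ρ) t) = shift (tsubst θ t).
Proof. unfold shift; rewrite !tsubst_comp; reflexivity. Qed.

Lemma up_ids V ρ : up ids = @ids (ext V ρ).
Proof. apply sub_ext; intros σ [|? v]; reflexivity. Qed.

Lemma up_comp V W U ρ (θ : sub V W) (θ' : sub W U) :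
  comp (up θ) (up θ') = up (ρ := ρ) (comp θ θ').
Proof.
  apply sub_ext; intros σ [|? v]; [reflexivity|].
  apply tsubst_up_shift.
Qed.

Lemma fsubst_ids V (A : fm V) : fsubst ids A = A.
Proof.
  induction A; simpl; rewrite ?tsubst_ids, ?up_ids; congruence.
Qed.

Lemma fsubst_comp V (A : fm V) : forall W U (θ : sub V W) (θ' : sub W U),
  fsubst θ' (fsubst θ A) = fsubst (comp θ θ') A.
Proof.
  induction A; intros; simpl; rewrite ?tsubst_comp; trivial;
    rewrite ?IHA, ?IHA1, ?IHA2, ?up_comp; trivial.
Qed.

Lemma fsubst_up_wks V W ρ (θ : sub V W) (A : fm V) :
  fsubst (up θ) (fsubst (wks (ρ := ρ)) A) = fsubst wks (fsubst θ A).
Proof. rewrite !fsubst_comp; reflexivity. Qed.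

Lemma comp_scons V W U ρ (t : tm W ρ) (θ : sub V W) (θ' : sub W U) :
  comp (scons t θ) θ' = scons (tsubst θ' t) (comp θ θ').
Proof. apply sub_ext; intros σ [|? v]; reflexivity. Qed.

Lemma comp_up_scons V W U ρ (t : tm U ρ) (θ : sub V W) (θ' : sub W U) :
  comp (up θ) (scons t θ') = scons t (comp θ θ').
Proof.
  apply sub_ext; intros σ [|? v]; [reflexivity|].
  apply tsubst_scons_shift.
Qed.

Lemma comp_ids_r V W (θ : sub V W) : comp θ ids = θ.
Proof. apply sub_ext; intros; apply tsubst_ids. Qed.

Lemma fsubst_inst V W ρ (θ : sub V W) (A : fm (ext V ρ)) t :
  fsubst θ (inst A t) = inst (fsubst (up θ) A) (tsubst θ t).
Proof.
  unfold inst; rewrite !fsubst_comp, comp_scons, comp_up_scons, comp_ids_r.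
  reflexivity.
Qed.

Lemma fsubst_eqt τ : forall V W (θ : sub V W) (s t : tm V τ),
  fsubst θ (eqt τ s t) = eqt τ (tsubst θ s) (tsubst θ t).
Proof.
  induction τ; intros; simpl; [reflexivity|].
  unfold all_named; simpl; rewrite IHτ2; simpl.
  unfold wk, wk_ext, wk_refl; rewrite !tsubst_up_shift; reflexivity.
Qed.

Lemma quantifier_free_fsubst V (A : fm V) : forall W (θ : sub V W),
  quantifier_free A -> quantifier_free (fsubst θ A).
Proof. induction A; simpl; intros; intuition. Qed.

(** * Substitution and weakening of derivations *)

Definition stable (T : theory) : Prop :=
  forall V W (θ : sub V W) A, T V A -> T W (fsubst θ A).

(** The two schemas absorb the substitution: the instance for [A] becomes the instance for [A]
    substituted under its binders. The axioms on [K], [S] and extensionality need [fsubst_eqt],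
    because [eqt] recurses on a type that is a variable here. *)
Lemma stable_RCA0w : stable RCA0w.
Proof.
  intros V W θ A H; destruct H as [V A H| | | | | | V A H | V A H].
  - apply ax_semiring; unfold ordered_semiring in *; simpl in H |- *.
    repeat (destruct H as [<- | H]; [cbn; tauto|]); contradiction.
  - pose proof (ax_K W ρ τ) as H; unfold all_named in *; simpl.
    rewrite fsubst_eqt; exact H.
  - pose proof (ax_S W δ ρ τ) as H; unfold all_named in *; simpl.
    rewrite fsubst_eqt; exact H.
  - apply ax_rec_zero.
  - apply ax_rec_succ.
  - pose proof (ax_ext W ρ τ) as H; unfold all_named in *; simpl.
    rewrite !fsubst_eqt; exact H.
  - simpl; rewrite fsubst_inst.
    replace (fsubst (up θ) (fsubst _ A)) with
      (fsubst (scons (t_app (t_app t_plus (t_var here)) t_one) wks) (fsubst (up θ) A)).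
    + apply ax_qf_ind; apply quantifier_free_fsubst, H.
    + rewrite !fsubst_comp, comp_scons, comp_up_scons; reflexivity.
  - pose proof (ax_qf_ac W _ (quantifier_free_fsubst A (up (up θ)) H)) as H'.
    unfold all_named, ex_named in *; simpl in *.
    rewrite !fsubst_comp, !comp_up_scons in H'.
    rewrite !fsubst_comp, !comp_scons.
    replace (comp wks2 (up (up θ))) with (comp θ (wks2 (ρ := ty2) (τ := ty1))).
    + exact H'.
    + apply sub_ext; intros σ v; symmetry; apply tsubst_comp.
Qed.

Lemma stable_add_axiom T (A : forall V, fm V) :
  stable T -> (forall V W (θ : sub V W), fsubst θ (A V) = A W) ->
  stable (add_axiom T A).
Proof.
  intros HT HA V W θ B [H | ->]; [left; auto | right; apply HA].
Qed.

Lemma prv_weak T V Γ A : prv T V Γ A ->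
  forall Δ, incl Γ Δ -> prv T V Δ A.
Proof.
  induction 1; intros Δ HΔ.
  - apply prv_ax; assumption.
  - apply prv_hyp; auto.
  - apply prv_impI, IHprv, incl_cons; [left; trivial | apply incl_tl, HΔ].
  - eapply prv_impE; eauto.
  - apply prv_conjI; auto.
  - eapply prv_conjE1; eauto.
  - eapply prv_conjE2; eauto.
  - apply prv_disjI1; auto.
  - apply prv_disjI2; auto.
  - eapply prv_disjE; [apply IHprv1, HΔ | apply IHprv2 | apply IHprv3];
      (apply incl_cons; [left; trivial | apply incl_tl, HΔ]).
  - apply prv_raa, IHprv, incl_cons; [left; trivial | apply incl_tl, HΔ].
  - apply prv_allI, IHprv, incl_map, HΔ.
  - apply prv_allE; auto.
  - eapply prv_exI; eauto.
  - eapply prv_exE; [apply IHprv1, HΔ|].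
    apply IHprv2, incl_cons; [left; trivial | apply incl_tl, incl_map, HΔ].
  - apply prv_eqI.
  - eapply prv_eqE; eauto.
Qed.

(** Used to turn a Henkin witness into an eigenvariable and to bring a derivation over the witnesses
    back to the empty context. *)
Lemma prv_subst T (HT : stable T) V Γ A : prv T V Γ A ->
  forall W (θ : sub V W), prv T W (map (fsubst θ) Γ) (fsubst θ A).
Proof.
  assert (E : forall V W ρ (θ : sub V W) Γ,
    map (fsubst wks) (map (fsubst θ) Γ)
    = map (fsubst (up θ)) (map (fsubst (wks (ρ := ρ))) Γ)).
  { intros; rewrite !map_map; apply map_ext; intros.
    symmetry; apply fsubst_up_wks. }
  induction 1; intros W θ; simpl in *.
  - apply prv_ax, HT; assumption.
  - apply prv_hyp, in_map; assumption.
  - apply prv_impI, IHprv.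
  - eapply prv_impE; [apply IHprv1 | apply IHprv2].
  - apply prv_conjI; auto.
  - eapply prv_conjE1, IHprv.
  - eapply prv_conjE2, IHprv.
  - apply prv_disjI1; auto.
  - apply prv_disjI2; auto.
  - eapply prv_disjE; [apply IHprv1 | apply IHprv2 | apply IHprv3].
  - apply prv_raa, IHprv.
  - apply prv_allI; rewrite E; apply IHprv.
  - rewrite fsubst_inst; apply prv_allE, IHprv.
  - apply prv_exI with (tsubst θ t); rewrite <- fsubst_inst; apply IHprv.
  - eapply prv_exE; [apply IHprv1|].
    rewrite E, <- fsubst_up_wks; apply IHprv2.
  - apply prv_eqI.
  - rewrite fsubst_inst; apply prv_eqE with (tsubst θ s); [apply IHprv1|].
    rewrite <- fsubst_inst; apply IHprv2.
Qed.

(** * Countability of the syntax *)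

(** In trees the leaf labels separate the constructors and injectivity is structural; Cantor pairing
    is then confined to [tree_code]. *)
Inductive tree : Set := leaf (n : nat) | node (a b : tree).

Fixpoint tree_code (t : tree) : nat :=
  match t with
  | leaf n => to_nat (0, n)
  | node a b => to_nat (S (tree_code a), tree_code b)
  end.

Lemma tree_code_inj s t : tree_code s = tree_code t -> s = t.
Proof.
  revert t; induction s as [n | a IHa b IHb]; intros [m | c d] H;
    cbn [tree_code] in H; apply to_nat_inj in H; try discriminate.
  - congruence.
  - injection H; intros; f_equal; auto.
Qed.

Fixpoint enc_ty (τ : ty) : tree :=
  match τ with
  | Nat => leaf 0
  | Arr σ τ => node (enc_ty σ) (enc_ty τ)
  end.

Lemma enc_ty_inj σ τ : enc_ty σ = enc_ty τ -> σ = τ.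
Proof.
  revert τ; induction σ; intros [|τ1 τ2]; simpl; try discriminate; auto.
  intros H; injection H; intros; f_equal; auto.
Qed.

Lemma ty_eq_dec (σ τ : ty) : {σ = τ} + {σ <> τ}.
Proof. decide equality. Defined.

Lemma ty_inj_pair2 (P : ty -> Type) τ (x y : P τ) :
  existT P τ x = existT P τ y -> x = y.
Proof. apply inj_pair2_eq_dec, ty_eq_dec. Qed.

(** Injectivity is stated across types, because the type of [u] is not visible in the type of
    [t_app s u] and has to be recovered from the code. *)
Definition injective_family {V : ty -> Set} (c : forall σ, V σ -> tree) : Prop :=
  forall σ v σ' v', c σ v = c σ' v' -> existT V σ v = existT V σ' v'.

Definition enc_ext {V : ty -> Set} (c : forall σ, V σ -> tree) ρ
  (σ : ty) (v : ext V ρ σ) : tree :=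
  match v with
  | here => leaf 0
  | there v => node (leaf 0) (c _ v)
  end.

Lemma enc_ext_inj (V : ty -> Set) (c : forall σ, V σ -> tree) ρ :
  injective_family c -> injective_family (enc_ext c (ρ := ρ)).
Proof.
  intros Hc σ [|? v] σ' [|? v']; simpl; try discriminate; [reflexivity|].
  intros H; injection H; intros H'; apply Hc in H'.
  exact (f_equal (fun p => existT (ext V ρ) _ (there (projT2 p))) H').
Qed.

Fixpoint enc_tm {V : ty -> Set} (c : forall σ, V σ -> tree) {τ} (t : tm V τ) : tree :=
  match t with
  | t_var v => node (leaf 0) (c _ v)
  | t_app s u => node (leaf 1) (node (enc_tm c s) (enc_tm c u))
  | t_zero => leaf 2
  | t_one => leaf 3
  | t_plus => leaf 4
  | t_times => leaf 5
  | t_K ρ τ => node (leaf 6) (node (enc_ty ρ) (enc_ty τ))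
  | t_S δ ρ τ => node (leaf 7) (node (enc_ty δ) (node (enc_ty ρ) (enc_ty τ)))
  | t_rec => leaf 8
  end.

Lemma enc_tm_inj (V : ty -> Set) (c : forall σ, V σ -> tree) (Hc : injective_family c)
  τ (t : tm V τ) : forall τ' (t' : tm V τ'),
  enc_tm c t = enc_tm c t' -> existT (tm V) τ t = existT (tm V) τ' t'.
Proof.
  induction t; intros τ' t'; destruct t'; simpl; intros H; try discriminate;
    try reflexivity; injection H; intros.
  - apply Hc in H0.
    exact (f_equal (fun p => existT (tm V) _ (t_var (projT2 p))) H0).
  - apply IHt1 in H1; apply IHt2 in H0.
    assert (E : existT (tm V) _ t1 = existT (tm V) _ t'1) by exact H1.
    apply (f_equal (@projT1 _ _)) in E; simpl in E; injection E; intros; subst.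
    apply ty_inj_pair2 in H1; apply ty_inj_pair2 in H0; subst; reflexivity.
  - apply enc_ty_inj in H0, H1; subst; reflexivity.
  - apply enc_ty_inj in H0, H1, H2; subst; reflexivity.
Qed.

Fixpoint enc_fm {V : ty -> Set} (c : forall σ, V σ -> tree) (A : fm V) : tree :=
  match A with
  | f_bot => leaf 0
  | f_eq s t => node (leaf 1) (node (enc_tm c s) (enc_tm c t))
  | f_lt s t => node (leaf 2) (node (enc_tm c s) (enc_tm c t))
  | f_imp A B => node (leaf 3) (node (enc_fm c A) (enc_fm c B))
  | f_and A B => node (leaf 4) (node (enc_fm c A) (enc_fm c B))
  | f_or A B => node (leaf 5) (node (enc_fm c A) (enc_fm c B))
  | f_all ρ A => node (leaf 6) (node (enc_ty ρ) (enc_fm (enc_ext c (ρ := ρ)) A))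
  | f_ex ρ A => node (leaf 7) (node (enc_ty ρ) (enc_fm (enc_ext c (ρ := ρ)) A))
  end.

Lemma enc_fm_inj (V : ty -> Set) (A : fm V) : forall (c : forall σ, V σ -> tree),
  injective_family c -> forall B, enc_fm c A = enc_fm c B -> A = B.
Proof.
  induction A; intros c Hc B; destruct B; simpl; intros H; try discriminate;
    try reflexivity; injection H; intros.
  1, 2: apply enc_tm_inj in H0, H1; trivial;
    apply ty_inj_pair2 in H0, H1; congruence.
  1, 2, 3: f_equal; eauto.
  1, 2: apply enc_ty_inj in H1; subst; f_equal;
    eapply IHA; [apply enc_ext_inj, Hc | eassumption].
Qed.

(* The Henkin witnesses: countably many variables of each type. *)
Definition con (_ : ty) : Set := nat.

Lemma fm_con_enumerable : exists e : nat -> fm con, forall A, exists n, e n = A.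
Proof.
  pose (c := fun (σ : ty) (v : con σ) => node (enc_ty σ) (leaf v)).
  assert (Hc : injective_family c).
  { unfold c; intros σ v σ' v' H; injection H; intros Hv Hσ.
    apply enc_ty_inj in Hσ; subst; reflexivity. }
  pose (R := fun n A => tree_code (enc_fm c A) = n).
  (* A left inverse of the code; a number that codes no formula gets an arbitrary value. *)
  exists (fun n => epsilon (inhabits f_bot) (R n)); intros A.
  exists (tree_code (enc_fm c A)); symmetry.
  apply enc_fm_inj with c; trivial; apply tree_code_inj; symmetry.
  refine (epsilon_spec (inhabits f_bot) (R (tree_code (enc_fm c A))) _).
  exists A; reflexivity.
Qed.

(** * Completeness for extensional structures *)

(** Henkin structures: at an arrow type [dom] is any type with an application, not the full function
    space. *)
Record structure : Type := {
  dom : ty -> Type;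
  ap : forall σ τ, dom (σ ⇒ τ) -> dom σ -> dom τ;
  i_zero : dom Nat;
  i_one : dom Nat;
  i_plus : dom (Nat ⇒ Nat ⇒ Nat);
  i_times : dom (Nat ⇒ Nat ⇒ Nat);
  i_K : forall ρ τ, dom (ρ ⇒ τ ⇒ ρ);
  i_S : forall δ ρ τ, dom ((δ ⇒ ρ ⇒ τ) ⇒ (δ ⇒ ρ) ⇒ δ ⇒ τ);
  i_rec : dom ((Nat ⇒ Nat ⇒ Nat) ⇒ Nat ⇒ Nat ⇒ Nat);
  i_lt : dom Nat -> dom Nat -> Prop
}.
Arguments ap {s σ τ} f x : rename.

Definition env (V : ty -> Set) (M : structure) : Type := forall σ, V σ -> dom M σ.

Definition econs {V M ρ} (d : dom M ρ) (e : env V M) : env (ext V ρ) M :=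
  fun σ v =>
    match v in ext _ _ σ return dom M ρ -> dom M σ with
    | here => fun d => d
    | there v => fun _ => e _ v
    end d.

Definition no_env {M} : env no_var M := fun σ v => match v with end.

Fixpoint eval {V M} (e : env V M) {τ} (t : tm V τ) : dom M τ :=
  match t with
  | t_var v => e _ v
  | t_app s t => ap (eval e s) (eval e t)
  | t_zero => i_zero M
  | t_one => i_one M
  | t_plus => i_plus M
  | t_times => i_times M
  | t_K ρ τ => i_K M ρ τ
  | t_S δ ρ τ => i_S M δ ρ τ
  | t_rec => i_rec M
  end.

Fixpoint sat {V M} (e : env V M) (A : fm V) : Prop :=
  match A with
  | f_bot => False
  | f_eq s t => eval e s = eval e t
  | f_lt s t => i_lt M (eval e s) (eval e t)
  | f_imp A B => sat e A -> sat e B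
  | f_and A B => sat e A /\ sat e B
  | f_or A B => sat e A \/ sat e B
  | f_all ρ A => forall d : dom M ρ, sat (econs d e) A
  | f_ex ρ A => exists d : dom M ρ, sat (econs d e) A
  end.

Definition extensional (M : structure) : Prop :=
  forall σ τ (f g : dom M (σ ⇒ τ)), (forall x, ap f x = ap g x) -> f = g.

Definition has_ext (T : theory) : Prop :=
  forall V ρ τ, T V (∀ x y ∈ ρ, ∀ φ ∈ ρ ⇒ τ,
    eqt ρ $x $y → eqt τ ($φ ⋅ $x) ($φ ⋅ $y))%ho.

(** A closed term of every type. It replaces the Henkin witnesses when a derivation returns to the
    empty context, and supplies the junk value of [lam]. *)
Fixpoint default {V : ty -> Set} (τ : ty) : tm V τ :=
  match τ with
  | Nat => t_zero
  | Arr σ τ => t_app (t_K τ σ) (default τ)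
  end.

Lemma prv_bot T V Γ A : prv T V Γ f_bot -> prv T V Γ A.
Proof. intros H; apply prv_raa; eapply prv_weak; [exact H | apply incl_tl, incl_refl]. Qed.

Lemma prv_head T V Γ A : prv T V (A :: Γ) A.
Proof. apply prv_hyp; left; trivial. Qed.

(** A counterexample to a false universal formula is thereby a witness of an existential one, the
    only kind the construction has to provide. *)
Lemma prv_not_all T V Γ ρ (A : fm (ext V ρ)) :
  prv T V Γ (f_imp (f_all ρ A) f_bot) ->
  prv T V Γ (f_ex ρ (f_imp A f_bot)).
Proof.
  intros H; apply prv_raa.
  eapply prv_impE; [eapply prv_weak; [exact H | apply incl_tl, incl_refl]|].
  apply prv_allI, prv_raa; simpl map.
  eapply prv_impE; [apply prv_hyp; right; left; reflexivity|].
  simpl; apply prv_exI with (t_var here).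
  replace (inst _ (t_var here)) with (f_imp A f_bot); [apply prv_head|].
  unfold inst; simpl; rewrite fsubst_comp, comp_up_scons.
  replace (scons _ _) with (@ids (ext V ρ)); [rewrite fsubst_ids; trivial|].
  apply sub_ext; intros σ [|? v]; reflexivity.
Qed.

(** * Henkin witnesses and the term model *)

Section Completeness.

Context (T : theory) (HT : stable T).

Definition consistent (Γ : list (fm con)) : Prop := ~ prv T con Γ f_bot.

(* Turns the witness [c] of type [ρ] into the bound variable. *)
Definition abstract_con (ρ : ty) (c : nat) : sub con (ext con ρ) :=
  fun σ v =>
    match ty_eq_dec ρ σ with
    | left e =>
        if Nat.eqb v c then eq_rect ρ (tm (ext con ρ)) (t_var here) σ e
        else t_var (there (v : con σ))
    | right _ => t_var (there (v : con σ))
    end.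

(** Freshness without sets of free variables: a formula mentions finitely many witnesses, so
    abstracting a large [c] acts on it as weakening does. The pointwise limit is preserved by [up],
    which carries it under binders. *)
Definition eventually_eq {V W} (θ : nat -> sub V W) (θ' : sub V W) : Prop :=
  forall σ v, exists N, forall c, N <= c -> θ c σ v = θ' σ v.

Lemma eventually_eq_tsubst V W (θ : nat -> sub V W) θ' : eventually_eq θ θ' ->
  forall τ (t : tm V τ), exists N, forall c, N <= c -> tsubst (θ c) t = tsubst θ' t.
Proof.
  intros H; induction t; simpl; try (exists 0; reflexivity); [apply H|].
  destruct IHt1 as [N1 H1], IHt2 as [N2 H2].
  exists (N1 + N2); intros c Hc; rewrite H1, H2 by lia; reflexivity.
Qed.

Lemma eventually_eq_up V W ρ (θ : nat -> sub V W) θ' : eventually_eq θ θ' ->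
  eventually_eq (fun c => up (ρ := ρ) (θ c)) (up θ').
Proof.
  intros H σ [|? v]; [exists 0; reflexivity|].
  destruct (H _ v) as [N HN]; exists N; intros c Hc; simpl.
  rewrite HN by trivial; reflexivity.
Qed.

Lemma eventually_eq_fsubst V (A : fm V) : forall W (θ : nat -> sub V W) θ',
  eventually_eq θ θ' ->
  exists N, forall c, N <= c -> fsubst (θ c) A = fsubst θ' A.
Proof.
  induction A; intros W θ θ' H; simpl; try (exists 0; reflexivity).
  1, 2: destruct (eventually_eq_tsubst H t) as [N1 H1],
          (eventually_eq_tsubst H t0) as [N2 H2];
        exists (N1 + N2); intros c Hc; rewrite H1, H2 by lia; reflexivity.
  1, 2, 3: destruct (IHA1 _ _ _ H) as [N1 H1], (IHA2 _ _ _ H) as [N2 H2];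
        exists (N1 + N2); intros c Hc; rewrite H1, H2 by lia; reflexivity.
  1, 2: destruct (IHA _ _ _ (eventually_eq_up H)) as [N HN];
        exists N; intros c Hc; rewrite HN by trivial; reflexivity.
Qed.

Lemma abstract_con_eventually ρ : eventually_eq (abstract_con ρ) wks.
Proof.
  intros σ v; exists (S v); intros c Hc; unfold abstract_con, wks.
  destruct (ty_eq_dec ρ σ); trivial.
  destruct (Nat.eqb_spec v c); [lia | trivial].
Qed.

Lemma abstract_con_self ρ (c : con ρ) : abstract_con ρ c c = t_var here.
Proof.
  unfold abstract_con; destruct (ty_eq_dec ρ ρ) as [e | n]; [|contradiction].
  rewrite Nat.eqb_refl, (UIP_dec ty_eq_dec e eq_refl); reflexivity.
Qed.

(** A large [c] is fresh for [C] and the context, so abstracting [c] turns a refutation of the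
    instance at [c] into the second premise of existential elimination. *)
Lemma henkin_witness Γ ρ (C : fm (ext con ρ)) :
  consistent (f_ex ρ C :: Γ) ->
  exists t, consistent (inst C t :: f_ex ρ C :: Γ).
Proof.
  intros HΓ.
  assert (HL : exists N, forall c, N <= c ->
    map (fsubst (abstract_con ρ c)) (f_ex ρ C :: Γ)
    = map (fsubst wks) (f_ex ρ C :: Γ)).
  { generalize (f_ex ρ C :: Γ) as Δ; clear.
    induction Δ as [|A Δ [N IH]]; [exists 0; reflexivity|].
    destruct (eventually_eq_fsubst A (abstract_con_eventually ρ)) as [N' H'].
    exists (N + N'); intros c Hc; simpl; rewrite IH, H' by lia; reflexivity. }
  assert (HC : exists N, forall c, N <= c ->
    fsubst (abstract_con ρ c) (inst C (t_var (c : con ρ))) = C).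
  (* Putting [c] for the bound variable and abstracting [c] again is the identity on [C] once [c] is
     fresh. *)
  { destruct (@eventually_eq_fsubst _ C _
      (fun c => scons (t_var here) (abstract_con ρ c)) ids) as [N HN].
    - intros σ [|? v]; [exists 0; reflexivity|].
      apply abstract_con_eventually.
    - exists N; intros c Hc; unfold inst; rewrite fsubst_comp, comp_scons; simpl.
      rewrite abstract_con_self; etransitivity; [apply (HN c Hc) | apply fsubst_ids]. }
  destruct HL as [N1 H1], HC as [N2 H2].
  set (c := N1 + N2); exists (t_var (c : con ρ)); intros H; apply HΓ.
  apply prv_subst with (θ := abstract_con ρ c) in H; trivial.
  rewrite map_cons in H; rewrite H1, H2 in H by lia.
  eapply prv_exE; [apply prv_head | exact H].
Qed.

Lemma extend_step (Γ : list (fm con)) (B : fm con) : consistent Γ ->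
  exists Δ, consistent Δ /\ incl Γ Δ
    /\ (prv T con Γ (f_imp B f_bot)
        \/ In B Δ
           /\ match B with
              | f_ex ρ C => exists t, In (inst C t) Δ
              | _ => True
              end).
Proof.
  intros HΓ; destruct (classic (consistent (B :: Γ))) as [H | H].
  - assert (D : (exists Δ, consistent Δ /\ incl (B :: Γ) Δ
      /\ match B with f_ex ρ C => exists t, In (inst C t) Δ | _ => True end)).
    { destruct B as [| | | | | | |ρ C];
        try (eexists; split; [exact H | split; [apply incl_refl | exact I]]).
      destruct (henkin_witness H) as [t Ht].
      eexists; split; [exact Ht|]; split; [apply incl_tl, incl_refl|].
      exists t; left; reflexivity. }
    destruct D as (Δ & H1 & H2 & H3); exists Δ; repeat split; trivial.
    + intros A HA; apply H2; right; trivial.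
    + right; split; trivial; apply H2; left; trivial.
  - exists Γ; repeat split; trivial; [apply incl_refl|].
    left; apply NNPP in H; apply prv_impI, H.
Qed.

Context (A0 : fm no_var) (HA0 : ~ provable T A0).

Definition start : list (fm con) :=
  [fsubst (fun σ (v : no_var σ) => match v with end) (f_imp A0 f_bot)].

Lemma start_consistent : consistent start.
Proof.
  intros H; apply HA0, prv_raa.
  apply (prv_subst HT) with (θ := (fun σ _ => default σ) : sub con no_var) in H.
  unfold start in H; cbn [map] in H; rewrite fsubst_comp in H.
  replace (comp _ _) with (@ids no_var) in H; [rewrite fsubst_ids in H; exact H|].
  apply sub_ext; intros σ [].
Qed.

(** The formulas are treated one after another along the enumeration by [extend_step]; [Ω] consists
    of what some stage derives. *)
Lemma maximal_consistent : exists Ω : fm con -> Prop,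
  (forall Γ A, (forall B, In B Γ -> Ω B) -> prv T con Γ A -> Ω A)
  /\ ~ Ω f_bot
  /\ (forall A, Ω A \/ Ω (f_imp A f_bot))
  /\ (forall ρ C, Ω (f_ex ρ C) -> exists t, Ω (inst C t))
  /\ (forall A, In A start -> Ω A).
Proof.
  destruct fm_con_enumerable as [e He].
  pose (next := fun n (Γ : {Γ | consistent Γ}) =>
    constructive_indefinite_description _ (extend_step (e n) (proj2_sig Γ))).
  pose (seq := nat_rect (fun _ => {Γ | consistent Γ})
    (exist _ start start_consistent)
    (fun n Γ => exist _ (proj1_sig (next n Γ)) (proj1 (proj2_sig (next n Γ))))).
  pose (G := fun n => proj1_sig (seq n)).
  assert (HG : forall n, consistent (G n)) by (intros n; apply (proj2_sig (seq n))).
  assert (Hs : forall n, incl (G n) (G (S n))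
    /\ (prv T con (G n) (f_imp (e n) f_bot)
        \/ In (e n) (G (S n))
           /\ match e n with
              | f_ex ρ C => exists t, In (inst C t) (G (S n))
              | _ => True
              end)) by (intros n; apply (proj2 (proj2_sig (next n (seq n))))).
  assert (Hm : forall n m, n <= m -> incl (G n) (G m)).
  { induction 1; [apply incl_refl|]; eapply incl_tran; [exact IHle | apply Hs]. }
  pose (Ω := fun A => exists n, prv T con (G n) A).
  assert (Hin : forall A n, In A (G n) -> Ω A)
    by (intros A n HA; exists n; apply prv_hyp, HA).
  (* The hypotheses may come from different stages; they are discharged one at a time, and a stage
     above all of them is reached. *)
  assert (Hd : forall Γ A, (forall B, In B Γ -> Ω B) -> prv T con Γ A -> Ω A).
  { intros Γ A HΓ HA.
    assert (HI : exists n, prv T con (G n) A); [|exact HI].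
    revert A HA; induction Γ as [|B Γ IH]; intros A HA.
    - exists 0; eapply prv_weak; [exact HA | intros ? []].
    - destruct (HΓ B) as [n Hn]; [left; trivial|].
      destruct (IH (fun C HC => HΓ C (or_intror HC)) (f_imp B A)) as [m Hp];
        [apply prv_impI, HA|].
      exists (n + m); eapply prv_impE; eapply prv_weak;
        [exact Hp | apply Hm; lia | exact Hn | apply Hm; lia]. }
  assert (Hb : ~ Ω f_bot) by (intros [n Hn]; exact (HG n Hn)).
  exists Ω; split; [exact Hd|]; split; [exact Hb|]; split; [|split].
  - intros A; destruct (He A) as [n <-]; destruct (Hs n) as [_ [H | [H _]]].
    + right; exists n; exact H.
    + left; exact (Hin _ _ H).
  - intros ρ C HC; destruct (He (f_ex ρ C)) as [n Hn]; destruct (Hs n) as [_ H].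
    rewrite Hn in H; destruct H as [H | [_ [t Ht]]].
    + exfalso; apply Hb, (Hd [f_imp (f_ex ρ C) f_bot; f_ex ρ C]).
      * intros B [<- | [<- | []]]; [exists n; exact H | exact HC].
      * eapply prv_impE; [apply prv_head | apply prv_hyp; right; left; trivial].
    + exists t; exact (Hin _ _ Ht).
  - intros A HA; apply (Hin A 0 HA).
Qed.

Context (HE : has_ext T).

(** [Ω] commutes with all connectives and, thanks to the witnesses, with the quantifiers over terms,
    so truth in the quotient of the terms is membership in [Ω]. *)
Lemma term_model : exists M : structure,
  extensional M /\ (forall V A (e : env V M), @T V A -> sat e A)
  /\ ~ sat (M := M) no_env A0.
Proof.
  destruct maximal_consistent as (Ω & Hd & Hb & Hc & Hw & Hst).
  assert (Hd0 : forall A, prv T con [] A -> Ω A) by (intros; eapply (Hd []); [intros ? []|trivial]).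
  assert (Hd1 : forall A B, Ω A -> prv T con [A] B -> Ω B)
    by (intros A B HA; apply Hd; intros ? [<- | []]; trivial).
  assert (Hd2 : forall A B C, Ω A -> Ω B -> prv T con [A; B] C -> Ω C)
    by (intros A B C HA HB; apply Hd; intros ? [<- | [<- | []]]; trivial).
  assert (Himp : forall A B, Ω (f_imp A B) <-> (Ω A -> Ω B)).
  { intros A B; split.
    - intros H HA; apply (Hd2 _ _ _ H HA).
      eapply prv_impE; [apply prv_head | apply prv_hyp; right; left; trivial].
    - intros H; destruct (Hc A) as [HA | HA].
      + apply (Hd1 B); auto; apply prv_impI, prv_hyp; right; left; trivial.
      + apply (Hd1 _ _ HA), prv_impI, prv_bot.
        eapply prv_impE; [apply prv_hyp; right; left; trivial | apply prv_head]. }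
  assert (Hand : forall A B, Ω (f_and A B) <-> (Ω A /\ Ω B)).
  { intros A B; split.
    - intros H; split; apply (Hd1 _ _ H);
        [eapply prv_conjE1, prv_head | eapply prv_conjE2, prv_head].
    - intros [HA HB]; apply (Hd2 _ _ _ HA HB), prv_conjI; [apply prv_head|].
      apply prv_hyp; right; left; trivial. }
  assert (Hor : forall A B, Ω (f_or A B) <-> (Ω A \/ Ω B)).
  { intros A B; split.
    - intros H; destruct (Hc A) as [HA | HA]; [left; trivial|right].
      apply (Hd2 _ _ _ H HA); eapply prv_disjE; [apply prv_head | | apply prv_head].
      apply prv_bot; eapply prv_impE; [apply prv_hyp; right; right; left; trivial|].
      apply prv_head.
    - intros [H | H]; apply (Hd1 _ _ H);
        [apply prv_disjI1, prv_head | apply prv_disjI2, prv_head]. }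
  assert (Hall : forall ρ A, Ω (f_all ρ A) <-> forall t, Ω (inst A t)).
  { intros ρ A; split.
    - intros H t; apply (Hd1 _ _ H), prv_allE, prv_head.
    - intros H; destruct (Hc (f_all ρ A)) as [HA | HA]; trivial; exfalso.
      destruct (Hw ρ (f_imp A f_bot)) as [t Ht].
      { apply (Hd1 _ _ HA), prv_not_all, prv_head. }
      apply Hb; exact (proj1 (Himp _ _) Ht (H t)). }
  assert (Hex : forall ρ A, Ω (f_ex ρ A) <-> exists t, Ω (inst A t)).
  { intros ρ A; split; [apply Hw|].
    intros [t H]; apply (Hd1 _ _ H), prv_exI with t, prv_head. }
  assert (Hrep : forall (A : fm (ext con Nat)) s t,
    Ω (f_eq s t) -> Ω (inst A s) -> Ω (inst A t)).
  { intros A s t Hst' HA; apply (Hd2 _ _ _ Hst' HA), prv_eqE with s;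
      [apply prv_head | apply prv_hyp; right; left; trivial]. }
  pose (eqv := fun τ (s t : tm con τ) => Ω (eqt τ s t)).
  assert (Harr : forall σ τ (s t : tm con (σ ⇒ τ)),
    eqv _ s t <-> forall z, eqv _ (t_app s z) (t_app t z)).
  { intros; unfold eqv; cbn [eqt]; unfold all_named; rewrite Hall.
    split; intros H z; specialize (H z); unfold inst in *; rewrite fsubst_eqt in *;
      cbn [tsubst] in *; unfold wk, wk_ext, wk_refl in *;
      rewrite !tsubst_scons_shift, !tsubst_ids in *; exact H. }
  assert (Hrefl : forall τ (t : tm con τ), eqv _ t t).
  { induction τ; intros; [apply Hd0, prv_eqI | apply Harr; auto]. }
  assert (Hsym : forall τ (s t : tm con τ), eqv _ s t -> eqv _ t s).
  { induction τ; intros s t H.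
    - pose proof (Hrep (f_eq (t_var here) (shift s)) s t H) as H'.
      unfold inst in H'; cbn in H'.
      rewrite !tsubst_scons_shift, !tsubst_ids in H'; apply H', (Hrefl Nat).
    - apply Harr; intros z; apply IHτ2, Harr, H. }
  assert (Htrans : forall τ (s t u : tm con τ), eqv _ s t -> eqv _ t u -> eqv _ s u).
  { induction τ; intros s t u H1 H2.
    - pose proof (Hrep (f_eq (shift s) (t_var here)) t u H2) as H'.
      unfold inst in H'; cbn in H'.
      rewrite !tsubst_scons_shift, !tsubst_ids in H'; apply H', H1.
    - apply Harr; intros z; eapply IHτ2; [apply Harr, H1 | apply Harr, H2]. }
  (* Replacement is a rule at type 0 only; at higher types the extensionality axiom makes
     application well defined on classes. *)
  assert (Hcong : forall σ τ (s t : tm con σ) (f : tm con (σ ⇒ τ)),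
    eqv _ s t -> eqv _ (t_app f s) (t_app f t)).
  { intros σ τ s t f H.
    pose proof (Hd0 _ (prv_ax T con [] _ (HE con σ τ))) as HA.
    unfold all_named in HA; rewrite Hall in HA; specialize (HA s).
    unfold inst in HA; simpl in HA; rewrite Hall in HA; specialize (HA t).
    unfold inst in HA; simpl in HA; rewrite Hall in HA; specialize (HA f).
    unfold inst in HA; simpl in HA; rewrite Himp in HA.
    rewrite !fsubst_eqt in HA; simpl in HA.
    unfold shift in HA; repeat rewrite !tsubst_comp in HA.
    unfold comp in HA; simpl in HA.
    rewrite !(tsubst_ids (V := con)) in HA.
    exact (HA H). }
  (* Terms modulo provable extensional equality, so that [=] interprets equality. *)
  pose (D := fun τ => {P : tm con τ -> Prop | exists t, P = eqv τ t}).
  pose (cls := fun τ t =>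
    exist (fun P => exists t, P = eqv τ t) (eqv τ t) (ex_intro _ t eq_refl) : D τ).
  pose (rep := fun τ (d : D τ) =>
    proj1_sig (constructive_indefinite_description _ (proj2_sig d))).
  assert (Hcls : forall τ (s t : tm con τ), cls τ s = cls τ t <-> eqv τ s t).
  { intros τ s t; split.
    - intros H; apply (f_equal (@proj1_sig _ _)) in H; simpl in H.
      apply Hsym; rewrite <- H; apply Hrefl.
    - intros H; apply subset_eq_compat, functional_extensionality; intros u.
      apply propositional_extensionality; split; intros Hu.
      + eapply Htrans; [apply Hsym, H | exact Hu].
      + eapply Htrans; [exact H | exact Hu]. }
  assert (Hcr : forall τ (d : D τ), cls τ (rep τ d) = d).
  { intros τ [P HP]; unfold rep; simpl.
    destruct (constructive_indefinite_description _ HP) as [t Ht]; simpl.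
    apply subset_eq_compat; symmetry; exact Ht. }
  assert (Hrc : forall τ t, eqv τ (rep τ (cls τ t)) t) by (intros; apply Hcls, Hcr).
  pose (M := {|
    dom := D;
    ap := fun σ τ f x => cls τ (t_app (rep _ f) (rep _ x));
    i_zero := cls _ t_zero;
    i_one := cls _ t_one;
    i_plus := cls _ t_plus;
    i_times := cls _ t_times;
    i_K := fun ρ τ => cls _ (t_K ρ τ);
    i_S := fun δ ρ τ => cls _ (t_S δ ρ τ);
    i_rec := cls _ t_rec;
    i_lt := fun d e => Ω (f_lt (rep _ d) (rep _ e)) |}).
  assert (Hap : forall σ τ (s : tm con (σ ⇒ τ)) t,
    ap (s := M) (cls _ s) (cls _ t) = cls _ (t_app s t)).
  { intros; apply Hcls; eapply Htrans; [apply Hcong, Hrc|].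
    apply (proj1 (Harr _ _ _ _) (Hrc _ s)). }
  assert (Hev : forall V (θ : sub V con) τ (t : tm V τ),
    eval (M := M) (fun σ v => cls σ (θ σ v)) t = cls τ (tsubst θ t)).
  { intros; induction t; simpl eval; simpl tsubst; try reflexivity.
    rewrite IHt1, IHt2; apply Hap. }
  assert (Hlt : forall s s' t t', eqv Nat s s' -> eqv Nat t t' ->
    Ω (f_lt s t) -> Ω (f_lt s' t')).
  { intros s s' t t' Hs Ht H.
    pose proof (Hrep (f_lt (t_var here) (shift t)) s s' Hs) as H1.
    pose proof (Hrep (f_lt (shift s') (t_var here)) t t' Ht) as H2.
    unfold inst in H1, H2; cbn in H1, H2.
    rewrite !tsubst_scons_shift, !tsubst_ids in H1, H2; auto. }
  assert (Hcons : forall V ρ (θ : sub V con) t,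
    econs (M := M) (cls ρ t) (fun σ v => cls σ (θ σ v))
    = fun σ v => cls σ (scons t θ σ v)).
  { intros; apply functional_extensionality_dep; intros σ.
    apply functional_extensionality; intros [|? v]; reflexivity. }
  assert (Hinst : forall V W ρ (θ : sub V W) (A : fm (ext V ρ)) t,
    inst (fsubst (up θ) A) t = fsubst (scons t θ) A).
  { intros; unfold inst; rewrite fsubst_comp, comp_up_scons, comp_ids_r; trivial. }
  (* Assignments induced by substitutions are enough: [rep] turns any assignment into one, and
     [Hcons] keeps the form under a quantifier. *)
  assert (Hsat : forall V (A : fm V) (θ : sub V con),
    sat (M := M) (fun σ v => cls σ (θ σ v)) A <-> Ω (fsubst θ A)).
  { intros V A; induction A; intros θ; simpl sat; simpl fsubst.
    - tauto.
    - rewrite !Hev; apply Hcls.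
    - rewrite !Hev; split; apply Hlt; auto.
    - rewrite Himp, IHA1, IHA2; tauto.
    - rewrite Hand, IHA1, IHA2; tauto.
    - rewrite Hor, IHA1, IHA2; tauto.
    - rewrite Hall; split.
      + intros H t; rewrite Hinst; apply IHA.
        rewrite <- Hcons; apply H.
      + intros H d; rewrite <- (Hcr _ d), Hcons; apply IHA.
        rewrite <- Hinst; apply H.
    - rewrite Hex; split.
      + intros [d H]; exists (rep _ d); rewrite Hinst; apply IHA.
        rewrite <- Hcons, Hcr; exact H.
      + intros [t H]; exists (cls _ t); rewrite Hcons; apply IHA.
        rewrite <- Hinst; exact H. }
  exists M; split; [|split].
  - intros σ τ f g H; rewrite <- (Hcr _ f), <- (Hcr _ g); apply Hcls, Harr.
    intros z; specialize (H (cls _ z)).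
    rewrite <- (Hcr _ f), <- (Hcr _ g), !Hap in H; apply Hcls, H.
  - intros V A e HA.
    replace e with (fun σ (v : V σ) => cls σ (rep σ (e σ v))).
    + apply Hsat, Hd0, prv_ax, HT, HA.
    + apply functional_extensionality_dep; intros σ.
      apply functional_extensionality; intros v; apply Hcr.
  - intros H.
    replace (@no_env M) with
      (fun σ (v : no_var σ) => cls σ (match v with end : tm con σ)) in H.
    + apply Hsat in H.
      assert (Hn : Ω (fsubst (fun σ (v : no_var σ) => match v with end)
        (f_imp A0 f_bot))) by (apply Hst; left; trivial).
      apply Hb; exact (proj1 (Himp _ _) Hn H).
    + apply functional_extensionality_dep; intros σ.
      apply functional_extensionality; intros [].
Qed.
End Completeness.

Theorem completeness T A : stable T -> has_ext T ->
  (forall M : structure, extensional M ->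
    (forall V B (e : env V M), T V B -> sat e B) ->
    sat (M := M) no_env A) ->
  provable T A.
Proof.
  intros HT HE H; apply NNPP; intros HA.
  destruct (term_model HT HA HE) as (M & H1 & H2 & H3); auto.
Qed.

(* The axioms in a fixed extensional structure *)
Declare Scope M_scope.
Delimit Scope M_scope with M.

Section Model.

Context (M : structure) (Mext : extensional M)
  (Max : forall V B (e : env V M), (RCA0w ⊕ IND1) V B -> sat e B).

Local Notation N := (dom M Nat).
Local Notation Seq := (dom M ty1).

Definition zero : N := i_zero M.
Definition one : N := i_one M.
Definition add (x y : N) : N := ap (ap (i_plus M) x) y.
Definition mul (x y : N) : N := ap (ap (i_times M) x) y.
Definition lt (x y : N) : Prop := i_lt M x y.
Definition le (x y : N) : Prop := lt x y \/ x = y.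

Local Notation "f ⋅ x" := (ap f x) (at level 20, left associativity) : M_scope.
Local Notation "0" := zero : M_scope.
Local Notation "1" := one : M_scope.
Local Infix "+" := add : M_scope.
Local Infix "*" := mul : M_scope.
Local Infix "<" := lt : M_scope.
Local Infix "<=" := le : M_scope.
Local Open Scope M_scope.

Lemma base_axiom V (B : fm V) (e : env V M) : RCA0w V B -> sat e B.
Proof. intros H; apply Max; left; exact H. Qed.

Lemma semiring_axiom (k : nat) : Peano.lt k 15 ->
  sat (M := M) no_env (nth k ordered_semiring f_bot).
Proof. intros H; apply base_axiom, ax_semiring, nth_In, H. Qed.

Ltac by_axiom k := exact (@semiring_axiom k ltac:(simpl; lia)).

Lemma addA : forall x y z, x + (y + z) = x + y + z. Proof. by_axiom 0%nat. Qed.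
Lemma addC : forall x y, x + y = y + x. Proof. by_axiom 1%nat. Qed.
Lemma add0 : forall x, x + 0 = x. Proof. by_axiom 2%nat. Qed.
Lemma mulA : forall x y z, x * (y * z) = x * y * z. Proof. by_axiom 3%nat. Qed.
Lemma mulC : forall x y, x * y = y * x. Proof. by_axiom 4%nat. Qed.
Lemma mul1 : forall x, x * 1 = x. Proof. by_axiom 5%nat. Qed.
Lemma mul0 : forall x, x * 0 = 0. Proof. by_axiom 6%nat. Qed.
Lemma mulD : forall x y z, x * (y + z) = x * y + x * z. Proof. by_axiom 7%nat. Qed.
Lemma lt_irrefl : forall x, ~ x < x. Proof. by_axiom 8%nat. Qed.
Lemma lt_trans : forall x y z, x < y -> y < z -> x < z. Proof. by_axiom 9%nat. Qed.
Lemma lt_total : forall x y, x < y \/ x = y \/ y < x. Proof. by_axiom 10%nat. Qed.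
Lemma lt_add : forall x y z, x < y -> x + z < y + z. Proof. by_axiom 11%nat. Qed.
Lemma lt_mul : forall x y z, 0 < z -> x < y -> x * z < y * z. Proof. by_axiom 12%nat. Qed.
Lemma lt_0_1 : 0 < 1. Proof. by_axiom 13%nat. Qed.
Lemma lt_x_0 : forall x, ~ x < 0. Proof. by_axiom 14%nat. Qed.

Lemma N_semiring : semi_ring_theory 0 1 add mul eq.
Proof.
  split; intros.
  - rewrite addC; apply add0.
  - apply addC.
  - apply addA.
  - rewrite mulC; apply mul1.
  - rewrite mulC; apply mul0.
  - apply mulC.
  - apply mulA.
  - rewrite mulC, mulD, (mulC p n), (mulC p m); reflexivity.
Qed.
Add Ring N_ring : N_semiring.

Lemma sat_eqt τ : forall V (e : env V M) (s t : tm V τ),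
  sat e (eqt τ s t) <-> eval e s = eval e t.
Proof.
  assert (Hs : forall V ρ σ (e : env V M) (d : dom M ρ) (t : tm V σ),
    eval (econs d e) (shift t) = eval e t).
  { intros; induction t; simpl; rewrite <- ?IHt1, <- ?IHt2; reflexivity. }
  induction τ as [|σ _ τ IH]; intros V e s t; [reflexivity|].
  cbn [eqt]; unfold all_named; simpl sat; split.
  - intros H; apply Mext; intros x; specialize (H x); apply IH in H; simpl in H.
    unfold wk, wk_ext, wk_refl in H; rewrite !Hs in H; exact H.
  - intros H x; apply IH; simpl.
    unfold wk, wk_ext, wk_refl; rewrite !Hs, H; reflexivity.
Qed.

Lemma K_eq ρ τ x y : i_K M ρ τ ⋅ x ⋅ y = x.
Proof.
  pose proof (base_axiom no_env (ax_K no_var ρ τ) x y) as H.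
  apply sat_eqt in H; exact H.
Qed.

Lemma S_eq δ ρ τ x y z : i_S M δ ρ τ ⋅ x ⋅ y ⋅ z = x ⋅ z ⋅ (y ⋅ z).
Proof.
  pose proof (base_axiom no_env (ax_S no_var δ ρ τ) x y z) as H.
  apply sat_eqt in H; exact H.
Qed.

Lemma rec_zero f m : i_rec M ⋅ f ⋅ m ⋅ 0 = m.
Proof. exact (base_axiom no_env (ax_rec_zero no_var) f m). Qed.

Lemma rec_succ f m n : i_rec M ⋅ f ⋅ m ⋅ (n + 1) = f ⋅ n ⋅ (i_rec M ⋅ f ⋅ m ⋅ n).
Proof. exact (base_axiom no_env (ax_rec_succ no_var) f m n). Qed.

(** This shape suffices to start arithmetic: the disjunction serves [y < n \/ y = n + monus y n],
    and later predicates become equations between a characteristic function and 0. *)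
Lemma ind_axiom (F G H K : Seq) :
  let P n := F ⋅ n < G ⋅ n \/ H ⋅ n = K ⋅ n in
  P 0 -> (forall n, P n -> P (n + 1)) -> forall n, P n.
Proof.
  intros P H0 HS.
  pose (V := ext (ext (ext (ext no_var ty1) ty1) ty1) ty1).
  pose (e := econs F (econs G (econs H (econs K no_env))) : env V M).
  pose (A := f_or
    (f_lt (t_app (t_var (there here)) (t_var here))
          (t_app (t_var (there (there here))) (t_var here)))
    (f_eq (t_app (t_var (there (there (there here)))) (t_var here))
          (t_app (t_var (there (there (there (there here))))) (t_var here)))
    : fm (ext V Nat)).
  pose proof (base_axiom e (ax_qf_ind V A ltac:(repeat split))) as HA.
  exact (HA (conj H0 HS)).
Qed.

Lemma choice_axiom (F : dom M (ty1 ⇒ Nat ⇒ Nat)) :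
  (forall f, exists n, F ⋅ f ⋅ n = 0) -> exists Y : dom M ty2, forall f, F ⋅ f ⋅ (Y ⋅ f) = 0.
Proof.
  intros H.
  pose (V := ext no_var (ty1 ⇒ Nat ⇒ Nat)).
  pose (e := econs F no_env : env V M).
  pose (A := f_eq (t_app (t_app (t_var (there (there here))) (t_var (there here)))
    (t_var here)) t_zero : fm (ext (ext V ty1) Nat)).
  exact (base_axiom e (ax_qf_ac V A I) H).
Qed.

Lemma ind1_axiom (Z : dom M (ty1 ⇒ Nat ⇒ Nat)) :
  (exists f, Z ⋅ f ⋅ 0 = 0) ->
  (forall n, (exists f, Z ⋅ f ⋅ n = 0) -> exists f, Z ⋅ f ⋅ (n + 1) = 0) ->
  forall n, exists f, Z ⋅ f ⋅ n = 0.
Proof.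
  intros H0 HS.
  exact (Max no_env (or_intror eq_refl : (RCA0w ⊕ IND1) no_var IND1) Z (conj H0 HS)).
Qed.

(** * Definable functions *)

Fixpoint tuple (c : list ty) : Type :=
  match c with
  | [] => unit
  | σ :: c => (tuple c * dom M σ)%type
  end.

(* [g], as a function of the arguments whose types [c] lists (the last one first),
   is given by an element of the structure. *)
Fixpoint rep (c : list ty) : forall τ, (tuple c -> dom M τ) -> Prop :=
  match c with
  | [] => fun _ _ => True
  | σ :: c => fun τ g =>
      exists F, rep c (σ ⇒ τ) F /\ forall e x, g (e, x) = F e ⋅ x
  end.

(** The element that represents [g], unique by extensionality, and junk if there is none;
    representability is thus a side condition of [lam_beta], not an argument. *)
Definition lam {σ τ} (g : dom M σ -> dom M τ) : dom M (σ ⇒ τ) :=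
  epsilon (inhabits (eval no_env (default _))) (fun F => forall x, F ⋅ x = g x).

Lemma rep_const c : forall τ (d : dom M τ), rep c τ (fun _ => d).
Proof.
  induction c as [|σ c IH]; intros τ d; simpl; trivial.
  exists (fun _ => i_K M τ σ ⋅ d); split; [apply IH|].
  intros; rewrite K_eq; reflexivity.
Qed.

(** Combinatory completeness by bracket abstraction: [S] distributes an argument over an
    application, [K] discards it in [rep_const] and [rep_skip]. *)
Lemma rep_app c : forall σ τ (f : tuple c -> dom M (σ ⇒ τ)) g,
  rep c _ f -> rep c _ g -> rep c τ (fun e => f e ⋅ g e).
Proof.
  induction c as [|ρ c IH]; intros σ τ f g; simpl; trivial.
  intros [F [HF EF]] [G [HG EG]].
  exists (fun e => i_S M ρ σ τ ⋅ F e ⋅ G e); split.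
  - apply IH; trivial; apply IH; trivial; apply rep_const.
  - intros; rewrite S_eq, EF, EG; reflexivity.
Qed.

Lemma rep_skip c σ τ (g : tuple c -> dom M τ) :
  rep c _ g -> rep (σ :: c) _ (fun e => g (fst e)).
Proof.
  intros H; exists (fun e => i_K M τ σ ⋅ g e); split.
  - apply rep_app; trivial; apply rep_const.
  - intros; rewrite K_eq; reflexivity.
Qed.

Fixpoint proj (c : list ty) : forall k, tuple c -> dom M (nth k c Nat) :=
  match c with
  | [] => fun k => match k with O | S _ => fun _ => 0 end
  | σ :: c => fun k =>
      match k with
      | O => fun e => snd e
      | S k => fun e => proj c k (fst e)
      end
  end.

Lemma rep_proj c : forall k, rep c _ (proj c k).
Proof.
  induction c as [|a c IH]; intros [|k]; try exact I.
  (* The identity as [S K K]. *)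
  - exists (fun _ => i_S M a (a ⇒ a) a ⋅ i_K M _ _ ⋅ i_K M _ _); split; [apply rep_const|].
    intros; rewrite S_eq, K_eq; reflexivity.
  - apply rep_skip, IH.
Qed.

Lemma lam_of σ τ (g : dom M σ -> dom M τ) F : (forall x, g x = F ⋅ x) -> lam g = F.
Proof.
  intros H; apply Mext; intros x; rewrite <- H; revert x.
  unfold lam; apply epsilon_spec; exists F; auto.
Qed.

(** The representation of [g] with one more argument is curried already, and extensionality
    identifies it with [lam (g e)]; so [lam] may occur under further abstractions. *)
Lemma rep_lam c σ τ (g : tuple c -> dom M σ -> dom M τ) :
  rep (σ :: c) τ (fun e => g (fst e) (snd e)) -> rep c (σ ⇒ τ) (fun e => lam (g e)).
Proof.
  intros [F [HF EF]]; replace (fun e => lam (g e)) with F; trivial.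
  apply functional_extensionality; intros e; symmetry; apply lam_of.
  intros x; exact (EF e x).
Qed.

Lemma lam_beta σ τ (g : dom M σ -> dom M τ) x :
  rep [σ] τ (fun e => g (snd e)) -> lam g ⋅ x = g x.
Proof.
  intros [F [_ EF]]; rewrite (@lam_of _ _ g (F tt)); [symmetry|intros]; exact (EF tt _).
Qed.

Lemma rep_add c (f g : tuple c -> N) :
  rep c Nat f -> rep c Nat g -> rep c Nat (fun e => f e + g e).
Proof.
  intros; unfold add; apply rep_app; trivial; apply rep_app; trivial; apply rep_const.
Qed.

Lemma rep_mul c (f g : tuple c -> N) :
  rep c Nat f -> rep c Nat g -> rep c Nat (fun e => f e * g e).
Proof.
  intros; unfold mul; apply rep_app; trivial; apply rep_app; trivial; apply rep_const.
Qed.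

Ltac var_index p :=
  lazymatch p with
  | (fun e => fst (@?q e)) => let k := var_index q in constr:(S k)
  | (fun e => e) => constr:(O)
  end.
Ltac rep_var :=
  lazymatch goal with
  | |- rep ?c _ (fun e => snd (@?p e)) => let k := var_index p in exact (rep_proj c k)
  | |- rep ?c _ snd => exact (rep_proj c O)
  end.
Ltac rep_step :=
  first [ rep_var | apply rep_const | apply rep_lam | apply rep_add | apply rep_mul
        | apply rep_app ].
Ltac rep := cbv beta; repeat rep_step.

(** * Arithmetic *)

Lemma ind_lt_eq (f g h k : N -> N) :
  rep [Nat] Nat (fun e => f (snd e)) -> rep [Nat] Nat (fun e => g (snd e)) ->
  rep [Nat] Nat (fun e => h (snd e)) -> rep [Nat] Nat (fun e => k (snd e)) ->
  let P n := f n < g n \/ h n = k n in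
  P 0 -> (forall n, P n -> P (n + 1)) -> forall n, P n.
Proof.
  intros [F [_ EF]] [G [_ EG]] [H [_ EH]] [K [_ EK]] P H0 HS n.
  pose proof (ind_axiom (F tt) (G tt) (H tt) (K tt)) as HI; cbv zeta in HI.
  assert (E : forall n, P n <-> F tt ⋅ n < G tt ⋅ n \/ H tt ⋅ n = K tt ⋅ n).
  { intros m; rewrite <- (EF tt m), <- (EG tt m), <- (EH tt m), <- (EK tt m).
    reflexivity. }
  apply E, HI; [apply E, H0 | intros m Hm; apply E, HS, E, Hm].
Qed.

Lemma ind_eq (h k : N -> N) :
  rep [Nat] Nat (fun e => h (snd e)) -> rep [Nat] Nat (fun e => k (snd e)) ->
  h 0 = k 0 -> (forall n, h n = k n -> h (n + 1) = k (n + 1)) ->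
  forall n, h n = k n.
Proof.
  intros Hh Hk H0 HS n.
  destruct (@ind_lt_eq (fun _ => 0) (fun _ => 0) h k) with (n := n) as [H | H]; trivial;
    try (rep; fail).
  - right; exact H0.
  - intros m [H | H]; [destruct (lt_irrefl _ H) | right; auto].
  - destruct (lt_irrefl _ H).
Qed.

(** The step [K] returns the counter and drops the previous value. In [monus] an outer [K] drops the
    counter, which leaves iterated predecessor. *)
Definition pred (n : N) : N := i_rec M ⋅ i_K M _ _ ⋅ 0 ⋅ n.
Definition sg (n : N) : N := i_rec M ⋅ (i_K M _ _ ⋅ (i_K M _ _ ⋅ 1)) ⋅ 0 ⋅ n.
Definition monus (m n : N) : N :=
  i_rec M ⋅ (i_K M _ _ ⋅ (i_rec M ⋅ i_K M _ _ ⋅ 0)) ⋅ m ⋅ n.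

Lemma pred_0 : pred 0 = 0. Proof. apply rec_zero. Qed.
Lemma pred_S n : pred (n + 1) = n.
Proof. unfold pred; rewrite rec_succ, K_eq; reflexivity. Qed.
Lemma sg_0 : sg 0 = 0. Proof. apply rec_zero. Qed.
Lemma sg_S n : sg (n + 1) = 1.
Proof. unfold sg; rewrite rec_succ, !K_eq; reflexivity. Qed.
Lemma monus_0 m : monus m 0 = m. Proof. apply rec_zero. Qed.
Lemma monus_S m n : monus m (n + 1) = pred (monus m n).
Proof. unfold monus; rewrite rec_succ, K_eq; reflexivity. Qed.

(** Two alternative equations do not fit [ind_lt_eq]. The factor [sg n] merges them into one
    equation, and idempotence with strict monotonicity of multiplication forces [sg n] to be 0 or
    1. *)
Lemma zero_or_succ n : n = 0 \/ n = pred n + 1.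
Proof.
  assert (H1 : forall n, n = sg n * (pred n + 1)).
  { apply ind_eq; [unfold pred, sg; rep .. | rewrite sg_0; ring |].
    intros m _; rewrite sg_S, pred_S; ring. }
  assert (H2 : forall n, sg n * sg n = sg n).
  { apply ind_eq; [unfold sg; rep .. | rewrite sg_0; ring |].
    intros m _; rewrite sg_S; ring. }
  specialize (H1 n); specialize (H2 n).
  assert (Hs : sg n = 0 \/ sg n = 1).
  { destruct (lt_total 0 (sg n)) as [H | [H | H]]; auto; [|destruct (lt_x_0 _ H)].
    destruct (lt_total (sg n) 1) as [H' | [H' | H']]; auto;
      pose proof (lt_mul _ _ _ H H') as H3; rewrite H2 in H3.
    - replace (1 * sg n) with (sg n) in H3 by ring; destruct (lt_irrefl _ H3).
    - replace (1 * sg n) with (sg n) in H3 by ring; destruct (lt_irrefl _ H3). }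
  destruct Hs as [Hs | Hs]; rewrite Hs in H1; [left | right].
  - rewrite H1; ring.
  - replace (1 * (pred n + 1)) with (pred n + 1) in H1 by ring; exact H1.
Qed.

Lemma add_cancel x y z : x + z = y + z -> x = y.
Proof.
  intros H; destruct (lt_total x y) as [H' | [H' | H']]; trivial;
    apply (lt_add _ _ z) in H'; rewrite H in H'; destruct (lt_irrefl _ H').
Qed.

Lemma pos_succ n : 0 < n + 1.
Proof.
  destruct (lt_total 0 n) as [H | [<- | H]].
  - apply lt_trans with n; trivial.
    pose proof (lt_add _ _ n lt_0_1) as H'.
    rewrite (addC 0 n), add0, (addC 1 n) in H'; exact H'.
  - rewrite addC, add0; apply lt_0_1.
  - destruct (lt_x_0 _ H).
Qed.

Lemma lt_add_succ x d : x < x + d + 1.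
Proof.
  pose proof (lt_add _ _ x (pos_succ d)) as H.
  replace (0 + x) with x in H by ring.
  replace (d + 1 + x) with (x + d + 1) in H by ring; exact H.
Qed.

Lemma lt_succ x : x < x + 1.
Proof. pose proof (lt_add_succ x 0) as H; rewrite add0 in H; exact H. Qed.

(** The axioms do not provide differences; [monus] does, by induction. From here on inequalities are
    proved by exhibiting a difference and calling [ring]. *)
Lemma lt_iff x y : x < y <-> exists d, y = x + d + 1.
Proof.
  split; [|intros [d ->]; apply lt_add_succ].
  intros H; assert (D : forall n, y < n \/ y = n + monus y n).
  { apply ind_lt_eq with (f := fun _ => y) (g := fun n => n) (h := fun _ => y)
      (k := fun n => n + monus y n); try (unfold monus; rep; fail).
    - right; rewrite monus_0; ring.
    - intros n [Hn | Hn]; [left; apply lt_trans with n; trivial; apply lt_succ|].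
      rewrite monus_S; destruct (zero_or_succ (monus y n)) as [E | E];
        [left | right]; rewrite E in Hn.
      + rewrite Hn, add0; apply lt_succ.
      + rewrite Hn at 1; ring. }
  destruct (D x) as [H' | H'].
  - elim (lt_irrefl _ (lt_trans _ _ _ H H')).
  - destruct (zero_or_succ (monus y x)) as [E | E]; rewrite E in H'.
    + rewrite H', add0 in H; elim (lt_irrefl _ H).
    + exists (pred (monus y x)); rewrite H' at 1; ring.
Qed.

Lemma le_iff x y : x <= y <-> exists d, y = x + d.
Proof.
  unfold le; rewrite lt_iff; split.
  - intros [[d ->] | ->]; [exists (d + 1) | exists 0]; ring.
  - intros [d ->]; destruct (zero_or_succ d) as [-> | E]; [right; ring|].
    left; exists (pred d); rewrite E at 1; ring.
Qed.

Lemma le_lt_succ x y : x < y + 1 <-> x <= y.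
Proof.
  rewrite lt_iff, le_iff; split; intros [d E]; exists d.
  - apply add_cancel with 1; rewrite E; ring.
  - rewrite E; ring.
Qed.

Lemma lt_le_succ x y : x < y <-> x + 1 <= y.
Proof. rewrite lt_iff, le_iff; split; intros [d E]; exists d; rewrite E; ring. Qed.

Lemma le_refl x : x <= x. Proof. right; trivial. Qed.
Lemma le_trans x y z : x <= y -> y <= z -> x <= z.
Proof. rewrite !le_iff; intros [d ->] [d' ->]; exists (d + d'); ring. Qed.
Lemma le_lt_trans x y z : x <= y -> y < z -> x < z.
Proof. rewrite !lt_iff, !le_iff; intros [d ->] [d' ->]; exists (d + d'); ring. Qed.
Lemma lt_le_trans x y z : x < y -> y <= z -> x < z.
Proof. rewrite !lt_iff, !le_iff; intros [d ->] [d' ->]; exists (d + d'); ring. Qed.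
Lemma le_antisym x y : x <= y -> y <= x -> x = y.
Proof.
  intros [H | H] [H' | H']; auto; elim (lt_irrefl _ (lt_trans _ _ _ H H')).
Qed.
Lemma le_or_lt x y : x <= y \/ y < x.
Proof. destruct (lt_total x y) as [H | [H | H]]; unfold le; auto. Qed.
Lemma le_total x y : x <= y \/ y <= x.
Proof. destruct (le_or_lt x y); [left | right; left]; trivial. Qed.
Lemma lt_not_le x y : x < y -> ~ y <= x.
Proof. intros H H'; apply (lt_irrefl x), lt_le_trans with y; trivial. Qed.
Lemma le_0 x : 0 <= x.
Proof. apply le_iff; exists x; ring. Qed.
Lemma le_0_eq x : x <= 0 -> x = 0.
Proof. intros [H | H]; trivial; elim (lt_x_0 _ H). Qed.
Lemma le_add x y d : x <= y -> x + d <= y + d.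
Proof. rewrite !le_iff; intros [k ->]; exists k; ring. Qed.
Lemma le_add2 x y x' y' : x <= y -> x' <= y' -> x + x' <= y + y'.
Proof. rewrite !le_iff; intros [k ->] [k' ->]; exists (k + k'); ring. Qed.
Lemma le_mul x y d : x <= y -> x * d <= y * d.
Proof. rewrite !le_iff; intros [k ->]; exists (k * d); ring. Qed.
Lemma le_add_r x y : x <= x + y.
Proof. apply le_iff; exists y; trivial. Qed.
Lemma le_add_l x y : x <= y + x.
Proof. apply le_iff; exists y; ring. Qed.
Lemma le_add_cancel x y d : x + d <= y + d -> x <= y.
Proof.
  rewrite !le_iff; intros [k E]; exists k; apply add_cancel with d; rewrite E; ring.
Qed.
Lemma le_mul_cancel x y d : 0 < d -> x * d <= y * d -> x <= y.
Proof.
  intros Hd H; destruct (le_or_lt x y) as [H' | H']; trivial.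
  elim (lt_irrefl (x * d)); eapply le_lt_trans; [exact H | apply lt_mul; trivial].
Qed.
Lemma mul_cancel x y d : 0 < d -> x * d = y * d -> x = y.
Proof.
  intros Hd H; apply le_antisym; apply le_mul_cancel with d; trivial;
    rewrite H; apply le_refl.
Qed.
Lemma mul_pos x y : 0 < x -> 0 < y -> 0 < x * y.
Proof.
  intros Hx Hy; replace 0 with (0 * y) by ring; apply lt_mul; trivial.
Qed.
Lemma mul_eq_0 x y : x * y = 0 <-> x = 0 \/ y = 0.
Proof.
  split; [|intros [-> | ->]; ring].
  intros H; destruct (zero_or_succ x) as [Hx | Hx]; auto.
  destruct (zero_or_succ y) as [Hy | Hy]; auto.
  elim (lt_irrefl 0); rewrite <- H at 2; rewrite Hx, Hy.
  apply mul_pos; apply pos_succ.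
Qed.
Lemma add_eq_0 x y : x + y = 0 <-> x = 0 /\ y = 0.
Proof.
  split; [|intros [-> ->]; ring].
  intros H; assert (Hx : x <= 0) by (rewrite <- H; apply le_add_r).
  apply le_0_eq in Hx; split; trivial; rewrite <- H, Hx; ring.
Qed.

Lemma monus_eq_0 x y : monus x y = 0 <-> x <= y.
Proof.
  assert (D : forall n, x < n \/ x = n + monus x n).
  { apply ind_lt_eq with (f := fun _ => x) (g := fun n => n) (h := fun _ => x)
      (k := fun n => n + monus x n); try (unfold monus; rep; fail).
    - right; rewrite monus_0; ring.
    - intros n [Hn | Hn]; [left; apply lt_trans with n; trivial; apply lt_succ|].
      rewrite monus_S; destruct (zero_or_succ (monus x n)) as [E | E];
        [left | right]; rewrite E in Hn.
      + rewrite Hn, add0; apply lt_succ.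
      + rewrite Hn at 1; ring. }
  split; intros H.
  - destruct (D y) as [H' | H']; [left; trivial|].
    rewrite H, add0 in H'; right; trivial.
  - apply le_iff in H; destruct H as [d E].
    assert (Z : forall k, monus x (x + k) = 0).
    { apply ind_eq; [unfold monus; rep .. | |].
      - rewrite add0; destruct (D x) as [H' | H']; [elim (lt_irrefl _ H')|].
        symmetry; apply add_cancel with x; rewrite addC, add0, addC; exact H'.
      - intros n Hn; rewrite addA, monus_S, Hn; apply pred_0. }
    rewrite E; apply Z.
Qed.

(** * Decidable predicates *)

(** With 0 for truth, conjunction is addition, disjunction is multiplication, and an inequality is a
    vanishing [monus]. *)
Definition dec (c : list ty) (P : tuple c -> Prop) : Prop :=
  exists χ, rep c Nat χ /\ forall e, χ e = 0 <-> P e.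

Lemma rep_monus c f g :
  rep c Nat f -> rep c Nat g -> rep c Nat (fun e => monus (f e) (g e)).
Proof. intros; unfold monus; repeat (apply rep_app || assumption || apply rep_const). Qed.

Lemma dec_ext c (P Q : tuple c -> Prop) : (forall e, Q e <-> P e) -> dec c P -> dec c Q.
Proof. intros H [χ [H1 H2]]; exists χ; split; trivial; intros; rewrite H2, H; tauto. Qed.

(** Excluded middle picks one of two constant functions; uniformity is asked for in the arguments
    only, not in outer parameters. *)
Lemma dec_const c (P : Prop) : dec c (fun _ => P).
Proof.
  destruct (classic P) as [H | H]; [exists (fun _ => 0) | exists (fun _ => 1)];
    (split; [apply rep_const|]); intros _; split; trivial; try tauto.
  intros E; elim (lt_irrefl 0); rewrite <- E at 2; apply lt_0_1.
Qed.

Lemma dec_le c f g :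
  rep c Nat f -> rep c Nat g -> dec c (fun e => f e <= g e).
Proof.
  intros; exists (fun e => monus (f e) (g e)); split; [apply rep_monus; trivial|].
  intros; apply monus_eq_0.
Qed.

Lemma dec_and c P Q : dec c P -> dec c Q -> dec c (fun e => P e /\ Q e).
Proof.
  intros [f [Hf Ef]] [g [Hg Eg]]; exists (fun e => f e + g e).
  split; [apply rep_add; trivial|].
  intros; rewrite add_eq_0, Ef, Eg; tauto.
Qed.

Lemma dec_or c P Q : dec c P -> dec c Q -> dec c (fun e => P e \/ Q e).
Proof.
  intros [f [Hf Ef]] [g [Hg Eg]]; exists (fun e => f e * g e).
  split; [apply rep_mul; trivial|].
  intros; rewrite mul_eq_0, Ef, Eg; tauto.
Qed.

Lemma dec_not c P : dec c P -> dec c (fun e => ~ P e).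
Proof.
  intros [f [Hf Ef]]; exists (fun e => monus 1 (f e)).
  split; [apply rep_monus; trivial; apply rep_const|].
  intros e; rewrite monus_eq_0, <- Ef; split.
  - intros H E; rewrite E in H; exact (lt_not_le lt_0_1 H).
  - intros H; destruct (zero_or_succ (f e)) as [E | E]; [contradiction|].
    rewrite E; apply le_add_l.
Qed.

Lemma dec_imp c P Q : dec c P -> dec c Q -> dec c (fun e => P e -> Q e).
Proof.
  intros HP HQ; apply dec_ext with (P := fun e => ~ P e \/ Q e); [intros; tauto|].
  apply dec_or; trivial; apply dec_not; trivial.
Qed.

Lemma dec_lt c f g :
  rep c Nat f -> rep c Nat g -> dec c (fun e => f e < g e).
Proof.
  intros; apply dec_ext with (P := fun e => f e + 1 <= g e).
  - intros; apply lt_le_succ.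
  - apply dec_le; trivial; apply rep_add; trivial; apply rep_const.
Qed.

Lemma dec_eq c f g :
  rep c Nat f -> rep c Nat g -> dec c (fun e => f e = g e).
Proof.
  intros; apply dec_ext with (P := fun e => f e <= g e /\ g e <= f e).
  - intros; split; [intros ->; split; apply le_refl | intros [? ?]; apply le_antisym; trivial].
  - apply dec_and; apply dec_le; trivial.
Qed.

Definition ite (P : Prop) (a b : N) : N := if excluded_middle_informative P then a else b.

Lemma ite_true (P : Prop) a b : P -> ite P a b = a.
Proof. unfold ite; destruct excluded_middle_informative; tauto. Qed.
Lemma ite_false (P : Prop) a b : ~ P -> ite P a b = b.
Proof. unfold ite; destruct excluded_middle_informative; tauto. Qed.

(** Recursion on the characteristic function: 0 returns [f], and a step that ignores its arguments
    returns [g] at every successor. *)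
Lemma rep_ite c P f g : dec c P -> rep c Nat f -> rep c Nat g ->
  rep c Nat (fun e => ite (P e) (f e) (g e)).
Proof.
  intros [χ [Hχ Eχ]] Hf Hg.
  replace (fun e => ite (P e) (f e) (g e))
    with (fun e => i_rec M ⋅ (i_K M _ _ ⋅ (i_K M _ _ ⋅ g e)) ⋅ f e ⋅ χ e).
  - repeat (apply rep_app || assumption || apply rep_const).
  - apply functional_extensionality; intros e.
    destruct (zero_or_succ (χ e)) as [E | E].
    + rewrite ite_true by (apply Eχ, E); rewrite E; apply rec_zero.
    + rewrite ite_false, E, rec_succ, !K_eq; trivial.
      rewrite <- Eχ, E; intros E0; elim (lt_irrefl 0).
      rewrite <- E0 at 2; apply pos_succ.
Qed.

Lemma nat_ind (P : N -> Prop) : dec [Nat] (fun e => P (snd e)) ->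
  P 0 -> (forall n, P n -> P (n + 1)) -> forall n, P n.
Proof.
  intros [χ [Hχ Eχ]] H0 HS n; apply (Eχ (tt, n)).
  apply (@ind_eq (fun n => χ (tt, n)) (fun _ => 0)); [|apply rep_const|apply Eχ, H0|].
  - destruct Hχ as [F [HF EF]]; exists F; split; trivial.
    intros [] x; apply EF.
  - intros m Hm; apply Eχ, HS, (proj1 (Eχ (tt, m)) Hm).
Qed.

(** * Choice of numbers *)

Definition cons_seq (n : N) (x : Seq) : Seq :=
  i_rec M ⋅ lam (fun i : N => lam (fun _ : N => x ⋅ i)) ⋅ n.
Definition tail_seq (x : Seq) : Seq := lam (fun i : N => x ⋅ (i + 1)).

Lemma cons_seq_0 n x : cons_seq n x ⋅ 0 = n.
Proof. apply rec_zero. Qed.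
Lemma cons_seq_S n x i : cons_seq n x ⋅ (i + 1) = x ⋅ i.
Proof. unfold cons_seq; rewrite rec_succ, lam_beta, lam_beta by rep; reflexivity. Qed.
Lemma tail_cons_seq n x : tail_seq (cons_seq n x) = x.
Proof.
  apply Mext; intros i; unfold tail_seq; rewrite lam_beta by rep; apply cons_seq_S.
Qed.

Lemma fun_of_rep3 σ ρ π τ (g : dom M σ -> dom M ρ -> dom M π -> dom M τ) :
  rep [π; ρ; σ] τ (fun e => g (snd (fst (fst e))) (snd (fst e)) (snd e)) ->
  exists F, forall x y z, F ⋅ x ⋅ y ⋅ z = g x y z.
Proof.
  intros [L [[G [[F [_ EF]] EG]] EL]]; exists (F tt); intros.
  rewrite <- EF, <- EG; symmetry; exact (EL (tt, x, y) z).
Qed.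

Lemma fun_of_rep2 σ ρ τ (g : dom M σ -> dom M ρ -> dom M τ) :
  rep [ρ; σ] τ (fun e => g (snd (fst e)) (snd e)) ->
  exists F, forall x y, F ⋅ x ⋅ y = g x y.
Proof.
  intros [G [[F [_ EF]] EG]]; exists (F tt); intros.
  rewrite <- EF; symmetry; exact (EG (tt, x) y).
Qed.

Lemma fun_of_rep1 σ τ (g : dom M σ -> dom M τ) :
  rep [σ] τ (fun e => g (snd e)) -> exists F, forall x, F ⋅ x = g x.
Proof. intros [F [_ EF]]; exists (F tt); intros; symmetry; exact (EF tt x). Qed.

Fixpoint reps (c c' : list ty) : (tuple c -> tuple c') -> Prop :=
  match c' with
  | [] => fun _ => True
  | σ :: c' => fun h => reps c c' (fun e => fst (h e)) /\ rep c σ (fun e => snd (h e))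
  end.

(** A definability proof made once for plain variables can then be reused at compound arguments,
    without unfolding again. *)
Lemma rep_comp c c' : forall τ (g : tuple c' -> dom M τ) (h : tuple c -> tuple c'),
  rep c' τ g -> reps c c' h -> rep c τ (fun e => g (h e)).
Proof.
  induction c' as [|σ c' IH]; intros τ g h.
  - intros _ _; replace (fun e => g (h e)) with (fun _ : tuple c => g tt).
    + apply rep_const.
    + apply functional_extensionality; intros e; destruct (h e); reflexivity.
  - intros [F [HF EF]] [H1 H2].
    replace (fun e => g (h e)) with (fun e => F (fst (h e)) ⋅ snd (h e)).
    + apply rep_app; trivial; apply (IH _ F _ HF H1).
    + apply functional_extensionality; intros e.
      rewrite <- EF; destruct (h e); reflexivity.
Qed.

Lemma dec_comp c c' (P : tuple c' -> Prop) (h : tuple c -> tuple c') :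
  dec c' P -> reps c c' h -> dec c (fun e => P (h e)).
Proof.
  intros [χ [Hχ Eχ]] Hh; exists (fun e => χ (h e)); split.
  - apply rep_comp; trivial.
  - intros e; apply Eχ.
Qed.

Lemma dec_elim c σ (P : dom M σ -> Prop) (h : tuple c -> dom M σ) :
  dec [σ] (fun e => P (snd e)) -> rep c σ h -> dec c (fun e => P (h e)).
Proof. intros HP Hh; exact (@dec_comp c [σ] _ (fun e => (tt, h e)) HP (conj I Hh)). Qed.

Lemma dec_fun3 σ ρ π (P : dom M σ -> dom M ρ -> dom M π -> Prop) :
  dec [π; ρ; σ] (fun e => P (snd (fst (fst e))) (snd (fst e)) (snd e)) ->
  exists F, forall x y z, F ⋅ x ⋅ y ⋅ z = 0 <-> P x y z.
Proof.
  intros [χ [Hχ Eχ]].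
  destruct (@fun_of_rep3 _ _ _ _ (fun x y z => χ (tt, x, y, z))) as [F HF].
  - replace (fun e : tuple [π; ρ; σ] => _) with χ; trivial.
    apply functional_extensionality; intros [[[[] x] y] z]; reflexivity.
  - exists F; intros; rewrite HF; apply (Eχ (tt, x, y, z)).
Qed.

Lemma choice_seq (P : Seq -> N -> Prop) :
  dec [Nat; ty1] (fun e => P (snd (fst e)) (snd e)) ->
  (forall f, exists n, P f n) -> exists Y : dom M ty2, forall f, P f (Y ⋅ f).
Proof.
  intros [χ [Hχ Eχ]] H.
  destruct (@fun_of_rep2 _ _ _ (fun f n => χ (tt, f, n))) as [F HF].
  - replace (fun e : tuple [Nat; ty1] => _) with χ; trivial.
    apply functional_extensionality; intros [[[] x] y]; reflexivity.
  - destruct (choice_axiom F) as [Y HY].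
    + intros f; destruct (H f) as [n Hn]; exists n; rewrite HF; apply Eχ; trivial.
    + exists Y; intros f; specialize (HY f); rewrite HF, Eχ in HY; exact HY.
Qed.

(** The axiom has a single argument of type 1, so the number is stored as the first entry of the
    sequence. *)
Lemma choice_seq_nat (P : Seq -> N -> N -> Prop) :
  dec [Nat; Nat; ty1] (fun e => P (snd (fst (fst e))) (snd (fst e)) (snd e)) ->
  (forall f m, exists n, P f m n) ->
  exists Y : dom M (ty1 ⇒ Nat ⇒ Nat), forall f m, P f m (Y ⋅ f ⋅ m).
Proof.
  intros HP H; destruct (dec_fun3 _ HP) as [F HF].
  destruct (@choice_seq (fun g n => F ⋅ tail_seq g ⋅ (g ⋅ 0) ⋅ n = 0)) as [Y HY].
  - apply dec_eq; unfold tail_seq; rep.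
  - intros f; destruct (H (tail_seq f) (f ⋅ 0)) as [n Hn]; exists n; apply HF, Hn.
  - destruct (@fun_of_rep2 _ _ _ (fun f m => Y ⋅ cons_seq m f)) as [G HG];
      [unfold cons_seq; rep|].
    exists G; intros f m; specialize (HY (cons_seq m f)).
    rewrite tail_cons_seq, cons_seq_0, HF in HY; rewrite HG; exact HY.
Qed.

Lemma choice_nat (P : N -> N -> Prop) :
  dec [Nat; Nat] (fun e => P (snd (fst e)) (snd e)) ->
  (forall m, exists n, P m n) -> exists h : Seq, forall m, P m (h ⋅ m).
Proof.
  intros [χ [Hχ Eχ]] H.
  destruct (@fun_of_rep2 _ _ _ (fun m n => χ (tt, m, n))) as [F HF].
  - replace (fun e : tuple [Nat; Nat] => _) with χ; trivial.
    apply functional_extensionality; intros [[[] x] y]; reflexivity.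
  - destruct (@choice_seq_nat (fun _ m n => F ⋅ m ⋅ n = 0)) as [Y HY].
    + apply dec_eq; rep.
    + intros _ m; destruct (H m) as [n Hn]; exists n; rewrite HF; apply Eχ; trivial.
    + exists (Y ⋅ (i_K M _ _ ⋅ 0)); intros m; specialize (HY (i_K M _ _ ⋅ 0) m).
      rewrite HF, Eχ in HY; exact HY.
Qed.

(** * Rational numbers *)

Lemma le_eq x y u v : x <= y -> u = x -> v = y -> u <= v.
Proof. intros H -> ->; exact H. Qed.
Lemma lt_eq x y u v : x < y -> u = x -> v = y -> u < v.
Proof. intros H -> ->; exact H. Qed.

Local Notation "2" := (1 + 1) : M_scope.
Local Notation "3" := (1 + 1 + 1) : M_scope.
Local Notation "4" := (1 + 1 + 1 + 1) : M_scope.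

Definition pow2 (n : N) : N :=
  i_rec M ⋅ (i_K M (Nat ⇒ Nat) Nat ⋅ (i_times M ⋅ 2)) ⋅ 1 ⋅ n.

Lemma pow2_0 : pow2 0 = 1. Proof. apply rec_zero. Qed.
Lemma pow2_S n : pow2 (n + 1) = 2 * pow2 n.
Proof. unfold pow2; rewrite rec_succ, K_eq; reflexivity. Qed.
Lemma pow2_add m n : pow2 (m + n) = pow2 m * pow2 n.
Proof.
  revert n; apply ind_eq; [unfold pow2; rep .. | rewrite pow2_0, add0; ring |].
  intros n H; rewrite addA, !pow2_S, H; ring.
Qed.
Lemma lt_pow2 n : n < pow2 n.
Proof.
  revert n; apply (@nat_ind (fun n => n < pow2 n)).
  - apply dec_lt; unfold pow2; rep.
  - rewrite pow2_0; apply lt_0_1.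
  - intros n H; apply lt_iff in H; destruct H as [d H].
    rewrite pow2_S, H; apply lt_iff; exists (n + d + d); ring.
Qed.
Lemma pow2_pos n : 0 < pow2 n.
Proof. apply le_lt_trans with n; [apply le_0 | apply lt_pow2]. Qed.
Lemma pow2_ge_1 n : 1 <= pow2 n.
Proof. eapply le_eq; [apply lt_le_succ, (pow2_pos n) | ring | reflexivity]. Qed.

(** This and the following predicates copy the formulas of the object language term by term, so that
    satisfaction converts to them. *)
Definition codes_nat_pair (c p m : N) : Prop := 2 * c = (p + m) * (p + m) + 3 * p + m.
Definition codes (c a b m : N) : Prop :=
  exists p, codes_nat_pair c p m /\ ((p = 2 * a /\ b = 0) \/ (p + 1 = 2 * b /\ a = 0)).

Definition Le (q r k n : N) : Prop :=
  exists a b m a' b' m',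
    codes q a b m /\ codes r a' b' m'
    /\ (a * (m' + 1) + b' * (m + 1)) * pow2 n
       <= (a' * (m + 1) + b * (m' + 1)) * pow2 n + k * ((m + 1) * (m' + 1)).
Definition Lt (q r k n : N) : Prop :=
  exists a b m a' b' m',
    codes q a b m /\ codes r a' b' m'
    /\ (a * (m' + 1) + b' * (m + 1)) * pow2 n
       < (a' * (m + 1) + b * (m' + 1)) * pow2 n + k * ((m + 1) * (m' + 1)).

(** With s = p + m the equation reads 2 c = s (s + 1) + 2 p with p at most s, so a larger s gives a
    larger c. *)
Lemma codes_nat_pair_le c p m p' m' :
  codes_nat_pair c p m -> codes_nat_pair c p' m' -> p' + m' <= p + m.
Proof.
  unfold codes_nat_pair; intros H H'.
  destruct (le_or_lt (p' + m') (p + m)) as [C | C]; trivial; exfalso.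
  apply lt_iff in C; destruct C as [d C].
  apply (lt_irrefl (2 * c)); rewrite H at 1; rewrite H'.
  apply lt_iff; exists (2 * m + 2 * (p + m) * d + d * d + 3 * d + 1 + 2 * p').
  transitivity ((p' + m') * (p' + m') + (p' + m') + 2 * p'); [ring|].
  rewrite C; ring.
Qed.

Lemma two_pos : 0 < 2.
Proof. apply pos_succ. Qed.

Lemma codes_nat_pair_unique c p m p' m' :
  codes_nat_pair c p m -> codes_nat_pair c p' m' -> p = p' /\ m = m'.
Proof.
  intros H H'.
  assert (Hs : p + m = p' + m')
    by (apply le_antisym; eapply codes_nat_pair_le; eassumption).
  unfold codes_nat_pair in *.
  assert (Hp : p = p').
  { apply mul_cancel with 2; [apply two_pos|].
    apply add_cancel with ((p + m) * (p + m) + (p + m)).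
    transitivity (2 * c); [rewrite H; ring|].
    rewrite Hs, H'; ring. }
  split; trivial; subst; apply add_cancel with p'.
  rewrite !(addC _ p'); exact Hs.
Qed.

Lemma even_not_odd a b : 2 * a + 1 <> 2 * b.
Proof.
  intros H; destruct (le_or_lt b a) as [C | C].
  - apply le_iff in C; destruct C as [d ->].
    apply (lt_irrefl (2 * b)); rewrite <- H at 2; apply lt_iff; exists (2 * d); ring.
  - apply lt_iff in C; destruct C as [d ->].
    apply (lt_irrefl (2 * a + 1)); rewrite H at 2; apply lt_iff; exists (2 * d); ring.
Qed.

Lemma codes_unique c a b m a' b' m' :
  codes c a b m -> codes c a' b' m' -> a = a' /\ b = b' /\ m = m'.
Proof.
  intros [p [Hp Hab]] [p' [Hp' Hab']].
  destruct (codes_nat_pair_unique Hp Hp') as [<- <-].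
  assert (H2 : forall x y, 2 * x = 2 * y -> x = y).
  { intros x y H; apply mul_cancel with 2; [apply two_pos|].
    rewrite !(mulC _ 2); exact H. }
  destruct Hab as [[-> ->] | [E ->]], Hab' as [[E' ->] | [E' ->]].
  - repeat split; auto.
  - elim (even_not_odd _ _ E').
  - rewrite E' in E; elim (even_not_odd _ _ E).
  - rewrite E in E'; repeat split; auto.
Qed.

Definition rational (q : N) : Prop := exists a b m, codes q a b m.

Lemma Le_codes q a b m r a' b' m' k n : codes q a b m -> codes r a' b' m' ->
  Le q r k n <->
  (a * (m' + 1) + b' * (m + 1)) * pow2 n
  <= (a' * (m + 1) + b * (m' + 1)) * pow2 n + k * ((m + 1) * (m' + 1)).
Proof.
  intros Hq Hr; split.
  - intros (a1 & b1 & m1 & a1' & b1' & m1' & Hq' & Hr' & H).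
    destruct (codes_unique Hq Hq') as (<- & <- & <-).
    destruct (codes_unique Hr Hr') as (<- & <- & <-); exact H.
  - intros H; exists a, b, m, a', b', m'; auto.
Qed.

Lemma Lt_codes q a b m r a' b' m' k n : codes q a b m -> codes r a' b' m' ->
  Lt q r k n <->
  (a * (m' + 1) + b' * (m + 1)) * pow2 n
  < (a' * (m + 1) + b * (m' + 1)) * pow2 n + k * ((m + 1) * (m' + 1)).
Proof.
  intros Hq Hr; split.
  - intros (a1 & b1 & m1 & a1' & b1' & m1' & Hq' & Hr' & H).
    destruct (codes_unique Hq Hq') as (<- & <- & <-).
    destruct (codes_unique Hr Hr') as (<- & <- & <-); exact H.
  - intros H; exists a, b, m, a', b', m'; auto.
Qed.

Lemma Le_rational q r k n : Le q r k n -> rational q /\ rational r.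
Proof.
  intros (a & b & m & a' & b' & m' & Hq & Hr & _); split; eexists _, _, _; eassumption.
Qed.

Lemma Lt_Le q r k n : Lt q r k n -> Le q r k n.
Proof.
  intros (a & b & m & a' & b' & m' & Hq & Hr & H).
  exists a, b, m, a', b', m'; repeat split; trivial; left; exact H.
Qed.

Lemma Le_trans q r s k k' n : Le q r k n -> Le r s k' n -> Le q s (k + k') n.
Proof.
  intros (a & b & m & a' & b' & m' & Hq & Hr & H) H'.
  destruct (Le_rational H') as [_ (a'' & b'' & m'' & Hs)].
  apply (Le_codes _ _ Hr Hs) in H'; apply (Le_codes _ _ Hq Hs).
  (* In the sum of the two inequalities, scaled to common denominators, the terms of the middle
     rational occur on both sides, and its denominator [m' + 1] is a factor of the rest. *)
  apply le_mul_cancel with (m' + 1); [apply pos_succ|].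
  apply le_add_cancel with ((b' + a') * (m + 1) * (m'' + 1) * pow2 n).
  refine (le_eq (le_add2 (le_mul (m'' + 1) H) (le_mul (m + 1) H')) _ _); ring.
Qed.

Lemma Le_weaken q r k k' n : Le q r k n -> k <= k' -> Le q r k' n.
Proof.
  intros (a & b & m & a' & b' & m' & Hq & Hr & H) Hk; apply (Le_codes _ _ Hq Hr).
  eapply le_trans; [exact H|]; apply le_add2; [apply le_refl | apply le_mul, Hk].
Qed.

Lemma Le_Lt q r k k' n : Le q r k n -> k < k' -> Lt q r k' n.
Proof.
  intros (a & b & m & a' & b' & m' & Hq & Hr & H) Hk; apply (Lt_codes _ _ Hq Hr).
  eapply le_lt_trans; [exact H|]; rewrite !(addC ((a' * _ + _) * _)); apply lt_add.
  apply lt_mul; trivial; apply mul_pos; apply pos_succ.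
Qed.

(** Brings errors of different precision to a common one before [Le_trans] adds them. *)
Lemma Le_scale q r k n j : Le q r k n <-> Le q r (pow2 j * k) (n + j).
Proof.
  assert (E : forall X Y W, X * pow2 n <= Y * pow2 n + k * W <->
    X * pow2 (n + j) <= Y * pow2 (n + j) + pow2 j * k * W).
  { intros; rewrite pow2_add; split; intros H.
    - refine (le_eq (le_mul (pow2 j) H) _ _); ring.
    - apply le_mul_cancel with (pow2 j); [apply pow2_pos|].
      refine (le_eq H _ _); ring. }
  split; intros (a & b & m & a' & b' & m' & Hq & Hr & H);
    apply (Le_codes _ _ Hq Hr), E; exact H.
Qed.

Lemma Le_refl q k n : rational q -> Le q q k n.
Proof.
  intros (a & b & m & Hq); apply (Le_codes _ _ Hq Hq), le_iff.
  exists (k * ((m + 1) * (m + 1))); ring.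
Qed.

Lemma Le_or q r : rational q -> rational r -> Le q r 0 0 \/ Le r q 0 0.
Proof.
  intros (a & b & m & Hq) (a' & b' & m' & Hr).
  destruct (le_total ((a * (m' + 1) + b' * (m + 1)) * pow2 0)
    ((a' * (m + 1) + b * (m' + 1)) * pow2 0)) as [H | H]; [left | right].
  - apply (Le_codes _ _ Hq Hr); refine (le_eq H _ _); ring.
  - apply (Le_codes _ _ Hr Hq); refine (le_eq H _ _); ring.
Qed.

Lemma Le_archimedean q r k K n :
  (forall j, Le q r (pow2 j * k + K) (n + j)) -> Le q r k n.
Proof.
  intros H; destruct (Le_rational (H 0)) as [(a & b & m & Hq) (a' & b' & m' & Hr)].
  apply (Le_codes _ _ Hq Hr).
  set (W := (m + 1) * (m' + 1)).
  set (U := (a * (m' + 1) + b' * (m + 1)) * pow2 n).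
  set (V := (a' * (m + 1) + b * (m' + 1)) * pow2 n + k * W).
  destruct (le_or_lt U V) as [C | C]; trivial; exfalso.
  (* A failure means that [U] exceeds [V] by at least 1. Scaled by 2^j this requires 2^j to be at
     most [K * W], which [lt_pow2] excludes at j = [K * W]. *)
  specialize (H (K * W)); apply (Le_codes _ _ Hq Hr) in H; fold W in H.
  rewrite pow2_add in H; set (P := pow2 (K * W)) in H.
  assert (H1 : U * P <= V * P + K * W) by (refine (le_eq H _ _); unfold U, V; ring).
  apply lt_iff in C; destruct C as [d E]; rewrite E in H1.
  apply (lt_not_le (lt_pow2 (K * W))); fold P.
  apply le_add_cancel with (V * P + d * P); eapply le_trans.
  - refine (le_eq H1 _ eq_refl); ring.
  - refine (le_eq (le_add_r (V * P + K * W) (d * P)) eq_refl _); ring.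
Qed.

(** Triangular numbers by recursion: they avoid the division by two in Cantor pairing. *)
Definition tri (n : N) : N :=
  i_rec M ⋅ lam (fun i : N => lam (fun r : N => r + (i + 1))) ⋅ 0 ⋅ n.

Lemma double_tri n : 2 * tri n = n * n + n.
Proof.
  revert n; apply ind_eq; [unfold tri; rep .. | |].
  - unfold tri; rewrite rec_zero; ring.
  - intros n H; replace (tri (n + 1)) with (tri n + (n + 1)).
    + transitivity (2 * tri n + 2 * (n + 1)); [ring | rewrite H; ring].
    + unfold tri; rewrite rec_succ, !lam_beta by rep; reflexivity.
Qed.

(* The code of [a / (m + 1)]. *)
Definition rat (a m : N) : N := tri (2 * a + m) + 2 * a.

Lemma codes_rat_code a m : codes (rat a m) a 0 m.
Proof.
  exists (2 * a); split; [|left; auto].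
  unfold codes_nat_pair, rat.
  transitivity (2 * tri (2 * a + m) + 4 * a); [ring | rewrite double_tri; ring].
Qed.

Lemma codes_0 : codes 0 0 0 0.
Proof. exists 0; split; [unfold codes_nat_pair; ring | left; split; ring]. Qed.

Lemma codes_5 : codes (1 + 1 + 1 + 1 + 1) 1 0 0.
Proof. exists 2; split; [unfold codes_nat_pair; ring | left; split; ring]. Qed.

(** * Real numbers *)

Definition isreal (x : Seq) : Prop :=
  forall n i, Lt (x ⋅ n) (x ⋅ (n + i)) 1 n /\ Lt (x ⋅ (n + i)) (x ⋅ n) 1 n.
Definition req (x y : Seq) : Prop :=
  forall n, Le (x ⋅ n) (y ⋅ n) 2 n /\ Le (y ⋅ n) (x ⋅ n) 2 n.
Definition rle (x y : Seq) : Prop := forall n, Le (x ⋅ n) (y ⋅ n) 2 n.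
Definition rzero : Seq := i_K M Nat Nat ⋅ 0.
Definition rone : Seq := i_K M Nat Nat ⋅ (1 + 1 + 1 + 1 + 1).
Definition unit_interval (x : Seq) : Prop := isreal x /\ rle rzero x /\ rle x rone.

Lemma isreal_rational x n : isreal x -> rational (x ⋅ n).
Proof. intros H; exact (proj1 (Le_rational (Lt_Le (proj1 (H n 0))))). Qed.

Lemma isreal_const q : rational q -> isreal (i_K M Nat Nat ⋅ q).
Proof.
  intros H n i; rewrite !K_eq.
  split; (apply Le_Lt with 0; [apply Le_refl, H | apply lt_0_1]).
Qed.

Lemma rational_0 : rational 0. Proof. eexists _, _, _; apply codes_0. Qed.
Lemma rational_5 : rational (1 + 1 + 1 + 1 + 1). Proof. eexists _, _, _; apply codes_5. Qed.

Lemma unit_interval_zero : unit_interval rzero.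
Proof.
  split; [apply isreal_const, rational_0|]; split; intros n; unfold rzero, rone; rewrite !K_eq.
  - apply Le_refl, rational_0.
  - apply (Le_codes _ _ codes_0 codes_5), le_iff; exists (pow2 n + 2); ring.
Qed.

(** Passing from index n to n + j costs 1/2^n for each of [x] and [y], while the given bound shrinks
    to K/2^(n+j); in the limit 2/2^n remains, whatever [K] is. *)
Lemma rle_of_bound x y K : isreal x -> isreal y ->
  (forall n, Le (x ⋅ n) (y ⋅ n) K n) -> rle x y.
Proof.
  intros Hx Hy H n; apply Le_archimedean with K; intros j.
  pose proof (Le_trans (proj1 (Le_scale _ _ _ _ j) (Lt_Le (proj1 (Hx n j)))) (H (n + j))) as H1.
  pose proof (Le_trans H1 (proj1 (Le_scale _ _ _ _ j) (Lt_Le (proj2 (Hy n j))))) as H2.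
  apply (Le_weaken H2); right; ring.
Qed.

Lemma rle_trans x y z : isreal x -> isreal z -> rle x y -> rle y z -> rle x z.
Proof.
  intros Hx Hz H H'; apply rle_of_bound with (2 + 2); trivial.
  intros n; exact (Le_trans (H n) (H' n)).
Qed.

Definition pow4 (n : N) : N := pow2 n * pow2 n.

Lemma pow4_pos n : 0 < pow4 n.
Proof. apply mul_pos; apply pow2_pos. Qed.
Lemma pow4_pred n : pred (pow4 n) + 1 = pow4 n.
Proof.
  destruct (zero_or_succ (pow4 n)) as [E | E]; [|symmetry; exact E].
  elim (lt_irrefl 0); rewrite <- E at 2; apply pow4_pos.
Qed.
Lemma pow4_add m n : pow4 (m + n) = pow4 m * pow4 n.
Proof. unfold pow4; rewrite pow2_add; ring. Qed.
Lemma pow4_1 : pow4 1 = 4.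
Proof.
  unfold pow4; replace 1 with (0 + 1) by ring; rewrite pow2_S, pow2_0; ring.
Qed.
Lemma pow2_double n : pow2 (n + n) = pow4 n.
Proof. apply pow2_add. Qed.

(** * Reals given by base 4 digits 0 and 3 *)

Section Digits.

Context (G : dom M (Nat ⇒ Nat ⇒ Nat)) (HG : forall n a, G ⋅ n ⋅ a <= 1).

(* The digit at place [n] is [3 * G n a], where [a / 4^n] is the number given by
   the digits before it. *)
Definition digits (H : dom M (Nat ⇒ Nat ⇒ Nat)) (n : N) : N :=
  i_rec M ⋅ lam (fun n : N => lam (fun a : N => 4 * a + 3 * (H ⋅ n ⋅ a))) ⋅ 0 ⋅ n.
Definition digits_real (H : dom M (Nat ⇒ Nat ⇒ Nat)) : Seq :=
  lam (fun n : N => rat (digits H n) (pred (pow4 n))).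

Lemma digits_0 H : digits H 0 = 0.
Proof. apply rec_zero. Qed.

Lemma digits_S H n : digits H (n + 1) = 4 * digits H n + 3 * (H ⋅ n ⋅ digits H n).
Proof. unfold digits; rewrite rec_succ, !lam_beta by rep; reflexivity. Qed.

Lemma digits_real_eq H n : digits_real H ⋅ n = rat (digits H n) (pred (pow4 n)).
Proof.
  apply lam_beta with (g := fun n => rat (digits H n) (pred (pow4 n))).
  unfold rat, tri, digits, pred, pow4, pow2; rep.
Qed.

Lemma digits_lower n i : digits G n * pow4 i <= digits G (n + i).
Proof.
  revert i; apply (@nat_ind (fun i => digits G n * pow4 i <= digits G (n + i))).
  - unfold digits, pow4, pow2; apply dec_le; rep.
  - right; rewrite add0; unfold pow4; rewrite pow2_0; ring.
  - intros i H; rewrite addA, digits_S, pow4_add, pow4_1.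
    eapply le_trans; [|apply le_add_r].
    refine (le_eq (le_mul 4 H) _ _); ring.
Qed.

(** The 1 on the left makes the induction work, since 4 a + 3 + 1 = 4 (a + 1); it also yields the
    strict inequality in [digits_real_unit]. *)
Lemma digits_upper n i : digits G (n + i) + 1 <= (digits G n + 1) * pow4 i.
Proof.
  revert i; apply (@nat_ind (fun i => digits G (n + i) + 1 <= (digits G n + 1) * pow4 i)).
  - unfold digits, pow4, pow2; apply dec_le; rep.
  - right; rewrite add0; unfold pow4; rewrite pow2_0; ring.
  - intros i H; rewrite addA, digits_S, pow4_add, pow4_1.
    set (a := digits G (n + i)) in *.
    apply le_trans with (4 * (a + 1)).
    + refine (le_eq (le_add2 (le_refl (4 * a + 1)) (le_mul 3 (HG (n + i) a))) _ _); ring.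
    + refine (le_eq (le_mul 4 H) _ _); ring.
Qed.

Lemma Le_rat_pow4 a b m n k j :
  Le (rat a (pred (pow4 m))) (rat b (pred (pow4 n))) k j <->
  a * pow4 n * pow2 j <= b * pow4 m * pow2 j + k * (pow4 m * pow4 n).
Proof.
  rewrite (Le_codes _ _ (codes_rat_code _ _) (codes_rat_code _ _)), !pow4_pred.
  split; intros H; refine (le_eq H _ _); ring.
Qed.

Lemma digits_real_lower n i :
  Le (rat (digits G n) (pred (pow4 n))) (digits_real G ⋅ (n + i)) 0 0.
Proof.
  rewrite digits_real_eq; apply Le_rat_pow4.
  rewrite pow2_0, pow4_add.
  refine (le_eq (le_mul (pow4 n) (digits_lower n i)) _ _); ring.
Qed.

Lemma digits_real_upper n i :
  Le (digits_real G ⋅ (n + i)) (rat (digits G n + 1) (pred (pow4 n))) 0 0.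
Proof.
  rewrite digits_real_eq; apply Le_rat_pow4.
  rewrite pow2_0, pow4_add.
  refine (le_eq (le_mul (pow4 n)
    (le_trans (le_add_r _ 1) (digits_upper n i))) _ _); ring.
Qed.

Lemma Le_0_scale q r k n : Le q r 0 0 -> Le q r k n.
Proof.
  intros H; apply (Le_scale _ _ _ _ n) in H.
  replace (0 + n) with n in H by ring; apply (Le_weaken H).
  replace (pow2 n * 0) with 0 by ring; apply le_0.
Qed.

Lemma digits_real_unit : unit_interval (digits_real G).
Proof.
  split; [|split].
  - intros n i; split; [apply Le_Lt with 0; [|apply lt_0_1]|].
    + rewrite (digits_real_eq _ n); apply Le_0_scale, digits_real_lower.
    + rewrite !digits_real_eq; apply (Lt_codes _ _ (codes_rat_code _ _) (codes_rat_code _ _)).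
      rewrite !pow4_pred, pow4_add.
      apply lt_le_trans with ((digits G n + 1) * pow4 i * (pow4 n * pow2 n)).
      * refine (lt_eq (lt_mul _ _ (pow4 n * pow2 n) (mul_pos _ _ (pow4_pos n) (pow2_pos n))
          (proj2 (lt_le_succ _ _) (digits_upper n i))) _ _); ring.
      * refine (le_eq (le_add2 (le_refl (digits G n * pow4 n * pow4 i * pow2 n))
          (le_mul (pow4 n * pow4 i * pow2 n) (pow2_ge_1 n))) _ _); unfold pow4; ring.
  - intros n; unfold rzero; rewrite K_eq, digits_real_eq.
    apply (Le_codes _ _ codes_0 (codes_rat_code _ _)); apply le_iff.
    exists (digits G n * pow2 n + 2 * (pred (pow4 n) + 1)); ring.
  - intros n; unfold rone; rewrite K_eq, digits_real_eq.
    apply (Le_codes _ _ (codes_rat_code _ _) codes_5); rewrite !pow4_pred.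
    pose proof (digits_upper 0 n) as H; rewrite digits_0 in H.
    replace (0 + n) with n in H by ring.
    eapply le_trans; [|apply le_add_r].
    refine (le_eq (le_mul (pow2 n) (le_trans (le_add_r _ 1) H)) _ _); ring.
Qed.

(** The index (n + 2) + (n + 2) makes the tolerance of [req] equal to 2/4^(n+2), half of the
    distance 1/4^(n+1) of the two rationals. *)
Lemma rat_gap b n :
  ~ Le (rat (b + 1) (pred (pow4 (n + 1)))) (rat b (pred (pow4 (n + 1))))
      2 (n + 2 + (n + 2)).
Proof.
  rewrite Le_rat_pow4, pow2_double; replace (n + 2) with (n + 1 + 1) by ring.
  rewrite (pow4_add (n + 1) 1), pow4_1; intros H.
  set (p := pow4 (n + 1)) in *.
  assert (Hp : 0 < p * p) by (apply mul_pos; apply pow4_pos).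
  assert (H' : 4 * b + 4 <= 4 * b + 2).
  { apply le_mul_cancel with (p * p); trivial; refine (le_eq H _ _); ring. }
  refine (lt_not_le _ H'); apply lt_iff; exists 1; ring.
Qed.

(* At place [n], [x] is compared with the midpoint of the current interval. *)
Lemma digits_real_avoids n x :
  let m := n + 2 + (n + 2) in
  let mid := rat (4 * digits G n + 2) (pred (pow4 (n + 1))) in
  (G ⋅ n ⋅ digits G n = 1 /\ Le (x ⋅ m) mid 0 0)
  \/ (G ⋅ n ⋅ digits G n = 0 /\ Le mid (x ⋅ m) 0 0) ->
  ~ req x (digits_real G).
Proof.
  intros m mid H Hreq.
  assert (Em : m = n + 1 + (n + 3)) by (unfold m; ring).
  pose proof (digits_real_lower (n + 1) (n + 3)) as Hl.
  pose proof (digits_real_upper (n + 1) (n + 3)) as Hu.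
  rewrite <- Em in Hl, Hu; rewrite digits_S in Hl, Hu.
  destruct H as [[HGn Hx] | [HGn Hx]]; rewrite HGn in Hl, Hu.
  (* Over the denominator 4^(n+1), with a = [digits G n], the midpoint is 4a + 2. Digit 3 puts the
     real at 4a + 3 or above, digit 0 at 4a + 1 or below, hence a full unit away on either side. *)
  - apply (@rat_gap (4 * digits G n + 2) n); fold m mid.
    replace (4 * digits G n + 3 * 1) with (4 * digits G n + 2 + 1) in Hl by ring.
    apply Le_weaken with (0 + 2 + 0); [|right; ring].
    eapply Le_trans; [eapply Le_trans; [apply Le_0_scale, Hl | apply Hreq]|].
    apply Le_0_scale, Hx.
  - apply (@rat_gap (4 * digits G n + 1) n); fold m.
    replace (4 * digits G n + 3 * 0 + 1) with (4 * digits G n + 1) in Hu by ring.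
    replace (4 * digits G n + 1 + 1) with (4 * digits G n + 2) by ring; fold mid.
    apply Le_weaken with (0 + 2 + 0); [|right; ring].
    eapply Le_trans; [eapply Le_trans; [apply Le_0_scale, Hx | apply Hreq]|].
    apply Le_0_scale, Hu.
Qed.

End Digits.

(** * Numerical quantification from an injection *)

Lemma ite_le_1 P : ite P 0 1 <= 1.
Proof.
  destruct (classic P); [rewrite ite_true by trivial; apply le_0|].
  rewrite ite_false by trivial; apply le_refl.
Qed.

(* The digits of [f] are 3 where [f] is not 0, so [Y] separates the resulting
   real from 0 exactly when [f] takes a nonzero value. *)
Lemma numerical_quantifier (Y : dom M ty2) :
  (forall x y, unit_interval x -> unit_interval y -> req x y -> Y ⋅ x = Y ⋅ y) ->
  (forall x y, unit_interval x -> unit_interval y -> Y ⋅ x = Y ⋅ y -> req x y) ->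
  exists E : dom M ty2, forall f, E ⋅ f = 0 <-> forall n, f ⋅ n = 0.
Proof.
  intros Hresp Hinj.
  pose (G := fun f : Seq => lam (fun n : N => lam (fun _ : N => ite (f ⋅ n = 0) 0 1))).
  assert (EG : forall f n a, G f ⋅ n ⋅ a = ite (f ⋅ n = 0) 0 1).
  { intros; unfold G; rewrite !lam_beta; trivial.
    - rep.
    - apply rep_lam; apply rep_ite; [apply dec_eq; rep | rep | rep]. }
  assert (HG : forall f n a, G f ⋅ n ⋅ a <= 1) by (intros; rewrite EG; apply ite_le_1).
  destruct (@fun_of_rep1 _ _ (fun f => ite (Y ⋅ digits_real (G f) = Y ⋅ rzero) 0 1)) as [E HE].
  { unfold digits_real, rat, tri, digits, pred, pow4, pow2, G.
    apply rep_ite; [apply dec_eq|rep|rep]; [|rep].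
    apply rep_app; [rep|].
    repeat first [rep_step | apply rep_ite | apply dec_eq]. }
  exists E; intros f; rewrite HE; split.
  - intros H n; apply NNPP; intros Hn.
    assert (HY : Y ⋅ digits_real (G f) = Y ⋅ rzero).
    { apply NNPP; intros C; rewrite ite_false in H by trivial.
      elim (lt_irrefl 0); rewrite <- H at 2; apply lt_0_1. }
    apply Hinj in HY; [|apply digits_real_unit; auto | apply unit_interval_zero].
    (* At index (n + 1) + (n + 1) the tolerance is 2/4^(n+1), less than the 3/4^(n+1) that digit n
       contributes. *)
    pose proof (digits_real_lower (G f) (n + 1) (n + 1)) as Hl.
    pose proof (Le_trans (Le_0_scale 0 (n + 1 + (n + 1)) Hl) (proj1 (HY _))) as H1.
    unfold rzero in H1; rewrite K_eq in H1.
    apply (Le_codes _ _ (codes_rat_code _ _) codes_0) in H1.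
    rewrite digits_S, EG, ite_false, pow2_double, pow4_pred in H1 by trivial.
    set (p := pow4 (n + 1)) in *; set (A := digits (G f) n) in *.
    assert (H2 : 4 * A + 3 <= 2).
    { apply le_mul_cancel with p; [apply pow4_pos|]; refine (le_eq H1 _ _); ring. }
    refine (lt_not_le _ H2); apply lt_iff; exists (4 * A); ring.
  - intros H; apply ite_true.
    apply Hresp; [apply digits_real_unit; auto | apply unit_interval_zero |].
    assert (HA : forall n, digits (G f) n = 0).
    { apply ind_eq; [unfold digits; rep .. | apply digits_0 |].
      intros n Hn; rewrite digits_S, EG, Hn, ite_true by apply H; ring. }
    intros n; unfold rzero; rewrite K_eq, digits_real_eq, HA.
    split; [apply (Le_codes _ _ (codes_rat_code _ _) codes_0)
           |apply (Le_codes _ _ codes_0 (codes_rat_code _ _))];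
      apply le_iff; exists (2 * (pred (pow4 n) + 1)); ring.
Qed.

(** * Consequences of numerical quantification *)

Section Quantifier.

Context (E2 : exists E : dom M ty2, forall f, E ⋅ f = 0 <-> forall n, f ⋅ n = 0).

(** As 0 stands for truth, [E] applied to a slice of the characteristic function tests whether all
    its values are true. *)
Lemma dec_all c (P : tuple c -> N -> Prop) :
  dec (Nat :: c) (fun e => P (fst e) (snd e)) -> dec c (fun e => forall n, P e n).
Proof.
  destruct E2 as [E HE]; intros [χ [Hχ Eχ]].
  exists (fun e => E ⋅ lam (fun n => χ (e, n))); split.
  - apply rep_app; [apply rep_const|]; apply rep_lam.
    replace (fun e : tuple (Nat :: c) => _) with χ; trivial.
    apply functional_extensionality; intros [e x]; reflexivity.
  - intros e; rewrite HE; destruct Hχ as [F [HF EF]].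
    rewrite (@lam_of _ _ _ (F e)) by (intros; apply EF).
    split; intros H n.
    + apply (Eχ (e, n)); rewrite EF; apply H.
    + rewrite <- EF; apply Eχ, (H n).
Qed.

Lemma dec_ex c (P : tuple c -> N -> Prop) :
  dec (Nat :: c) (fun e => P (fst e) (snd e)) -> dec c (fun e => exists n, P e n).
Proof.
  intros H; apply dec_ext with (P := fun e => ~ forall n, ~ P e n).
  - intros e; split; [intros [n Hn] H'; exact (H' n Hn)|].
    intros H'; apply not_all_not_ex; exact H'.
  - apply dec_not, dec_all; apply dec_not with (P := fun e => P (fst e) (snd e)), H.
Qed.

Lemma dec_seq_eq c (f g : tuple c -> Seq) :
  rep c ty1 f -> rep c ty1 g -> dec c (fun e => f e = g e).
Proof.
  intros Hf Hg; apply dec_ext with (P := fun e => forall n, f e ⋅ n = g e ⋅ n).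
  - intros e; split; [intros -> n; trivial | apply Mext].
  - apply dec_all, dec_eq; (apply rep_app; [|rep]);
      [exact (@rep_skip c Nat _ f Hf) | exact (@rep_skip c Nat _ g Hg)].
Qed.

Ltac dec_step :=
  first [ apply dec_const | apply dec_le | apply dec_lt | apply dec_eq | apply dec_seq_eq
        | apply dec_and | apply dec_or | apply dec_not | apply dec_all | apply dec_ex
        | apply dec_imp | rep_step | apply rep_ite ].
Ltac dec := repeat dec_step.

(** The induction is on the failure of [P] below [k], a bounded quantification that [dec_all] makes
    decidable. *)
Lemma least (P : N -> Prop) : dec [Nat] (fun e => P (snd e)) ->
  (exists n, P n) -> exists n, P n /\ forall m, m < n -> ~ P m.
Proof.
  intros HP [n Hn]; apply NNPP; intros H.
  assert (D : forall k m, m < k -> ~ P m).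
  { apply (@nat_ind (fun k => forall m, m < k -> ~ P m)).
    - apply dec_all; apply dec_imp; [dec|]; apply dec_not; apply dec_elim; [exact HP|rep].
    - intros m Hm; elim (lt_x_0 _ Hm).
    - intros k IH m Hm Pm; apply le_lt_succ in Hm; destruct Hm as [Hm | ->].
      + exact (IH m Hm Pm).
      + apply H; exists k; split; trivial. }
  exact (D (n + 1) n (lt_succ n) Hn).
Qed.

(** * Normal forms of reals *)

Lemma Lt_unscale q r k n j : Lt q r (pow2 j * k) (n + j) -> Lt q r k n.
Proof.
  intros (a & b & m & a' & b' & m' & Hq & Hr & H); apply (Lt_codes _ _ Hq Hr).
  destruct (le_or_lt ((a' * (m + 1) + b * (m' + 1)) * pow2 n + k * ((m + 1) * (m' + 1)))
    ((a * (m' + 1) + b' * (m + 1)) * pow2 n)) as [C | C]; trivial.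
  elim (lt_not_le H); rewrite pow2_add.
  refine (le_eq (le_mul (pow2 j) C) _ _); ring.
Qed.

Lemma pow2_2 : pow2 2 = 4.
Proof.
  replace 2 with (0 + 1 + 1) by ring; rewrite !pow2_S, pow2_0; ring.
Qed.

(* [|x - c| <= 1 / 2^(n + 2)]: the error term [K / 2^(n + 2 + m)] vanishes as [m]
   grows, and leaving [K] unspecified makes the notion invariant under [req]. *)
Definition near (x : Seq) (n c : N) : Prop :=
  exists K, forall m,
    Le c (x ⋅ (n + 2 + m)) (pow2 m * 1 + K) (n + 2 + m)
    /\ Le (x ⋅ (n + 2 + m)) c (pow2 m * 1 + K) (n + 2 + m).

Lemma near_self x n : isreal x -> near x n (x ⋅ (n + 2)).
Proof.
  intros Hx; exists 0; intros m; rewrite add0.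
  split; apply Le_scale, Lt_Le; apply Hx.
Qed.

Lemma near_req x y n c : req x y -> near x n c -> near y n c.
Proof.
  intros H [K HK]; exists (K + 2); intros m.
  destruct (HK m) as [H1 H2], (H (n + 2 + m)) as [H3 H4]; split.
  - apply (Le_weaken (Le_trans H1 H3)); right; ring.
  - apply (Le_weaken (Le_trans H4 H2)); right; ring.
Qed.

Lemma req_sym x y : req x y -> req y x.
Proof. intros H n; destruct (H n); split; trivial. Qed.

Lemma rep_pow2 c f : rep c Nat f -> rep c Nat (fun e => pow2 (f e)).
Proof. intros H; unfold pow2; apply rep_app; [rep | exact H]. Qed.

Lemma dec_Le c f g h k : rep c Nat f -> rep c Nat g -> rep c Nat h -> rep c Nat k ->
  dec c (fun e => Le (f e) (g e) (h e) (k e)).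
Proof.
  intros Hf Hg Hh Hk.
  assert (D : dec [Nat; Nat; Nat; Nat] (fun e =>
    Le (snd (fst (fst (fst e)))) (snd (fst (fst e))) (snd (fst e)) (snd e)))
    by (unfold Le, codes, codes_nat_pair, pow2; dec).
  exact (@dec_comp c [Nat; Nat; Nat; Nat] _ (fun e => (tt, f e, g e, h e, k e)) D
    (conj (conj (conj (conj I Hf) Hg) Hh) Hk)).
Qed.

Lemma dec_Lt c f g h k : rep c Nat f -> rep c Nat g -> rep c Nat h -> rep c Nat k ->
  dec c (fun e => Lt (f e) (g e) (h e) (k e)).
Proof.
  intros Hf Hg Hh Hk.
  assert (D : dec [Nat; Nat; Nat; Nat] (fun e =>
    Lt (snd (fst (fst (fst e)))) (snd (fst (fst e))) (snd (fst e)) (snd e)))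
    by (unfold Lt, codes, codes_nat_pair, pow2; dec).
  exact (@dec_comp c [Nat; Nat; Nat; Nat] _ (fun e => (tt, f e, g e, h e, k e)) D
    (conj (conj (conj (conj I Hf) Hg) Hh) Hk)).
Qed.

Ltac dec_real := repeat first [apply dec_Le | apply dec_Lt | apply rep_pow2 | dec_step].

Lemma dec_near c f n a : rep c ty1 f -> rep c Nat n -> rep c Nat a ->
  dec c (fun e => near (f e) (n e) (a e)).
Proof.
  intros Hf Hn Ha.
  assert (D : dec [Nat; Nat; ty1] (fun e => near (snd (fst (fst e))) (snd (fst e)) (snd e)))
    by (unfold near; dec_real).
  exact (@dec_comp c [Nat; Nat; ty1] _ (fun e => (tt, f e, n e, a e)) D (conj (conj (conj I Hf) Hn) Ha)).
Qed.

Lemma dec_unit_interval c f : rep c ty1 f -> dec c (fun e => unit_interval (f e)).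
Proof.
  intros Hf; apply dec_elim; trivial.
  unfold unit_interval, isreal, rle, rzero, rone; dec_real.
Qed.

(** The least code of a nearby rational depends on the value of [x] only, because [near] does. The
    premise makes the chosen relation total, also where [x] is not a real. *)
Lemma normal_form_exists : exists F : dom M (ty1 ⇒ ty1), forall x n,
  (exists c, near x n c) ->
  near x n (F ⋅ x ⋅ n) /\ forall c, c < F ⋅ x ⋅ n -> ~ near x n c.
Proof.
  apply (@choice_seq_nat (fun x n d => (exists c, near x n c) ->
    near x n d /\ forall c, c < d -> ~ near x n c)).
  - repeat first [apply dec_near | dec_step].
  - intros x n; destruct (classic (exists c, near x n c)) as [H | H];
      [|exists 0; tauto].
    destruct (@least (near x n)) as [d Hd]; trivial.
    + repeat first [apply dec_near | dec_step].
    + exists d; auto.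
Qed.

Section NormalForm.

Context (F : dom M (ty1 ⇒ ty1)) (HF : forall x n,
  (exists c, near x n c) ->
  near x n (F ⋅ x ⋅ n) /\ forall c, c < F ⋅ x ⋅ n -> ~ near x n c).

Lemma normal_form_near x n : isreal x -> near x n (F ⋅ x ⋅ n).
Proof. intros Hx; apply HF; eexists; apply near_self, Hx. Qed.

Lemma normal_form_unique x y : isreal x -> isreal y -> req x y -> F ⋅ x = F ⋅ y.
Proof.
  intros Hx Hy Hxy; apply Mext; intros n.
  assert (L : forall u v, isreal u -> isreal v -> req u v -> F ⋅ u ⋅ n <= F ⋅ v ⋅ n).
  { intros u v Hu Hv Huv.
    destruct (le_or_lt (F ⋅ u ⋅ n) (F ⋅ v ⋅ n)) as [C | C]; trivial; exfalso.
    assert (E : exists c, near u n c) by (eexists; apply near_self, Hu).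
    apply (proj2 (HF E) _ C), near_req with v; [apply req_sym, Huv|].
    apply normal_form_near, Hv. }
  apply le_antisym; apply L; trivial; apply req_sym, Hxy.
Qed.

Lemma normal_form_req x : isreal x -> req x (F ⋅ x).
Proof.
  intros Hx n; destruct (normal_form_near n Hx) as [K HK].
  (* The error is 1/2^n for moving along [x] plus 1/2^(n+2) for [near], that is 5/2^(n+2), against
     the allowed 8/2^(n+2). *)
  assert (L : forall q r, Le q r (4 + 1) (n + 2) -> Le q r 2 n).
  { intros q r H; apply (Le_scale _ _ _ _ 2); apply (Le_weaken H).
    rewrite pow2_2; apply le_iff; exists 3; ring. }
  assert (S : forall q r m, Le q r 1 n -> Le q r (pow2 m * 4) (n + 2 + m)).
  { intros q r m H; apply (Le_scale _ _ _ _ (2 + m)) in H.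
    replace (n + (2 + m)) with (n + 2 + m) in H by ring.
    apply (Le_weaken H); right; rewrite pow2_add, pow2_2; ring. }
  split; apply L, Le_archimedean with K; intros m; destruct (HK m) as [H1 H2];
    destruct (Hx n (2 + m)) as [H3 H4];
    replace (n + (2 + m)) with (n + 2 + m) in H3, H4 by ring.
  - apply (Le_weaken (Le_trans (S _ _ m (Lt_Le H3)) H2)); right; ring.
  - apply (Le_weaken (Le_trans H1 (S _ _ m (Lt_Le H4)))); right; ring.
Qed.

Lemma normal_form_real x : isreal x -> isreal (F ⋅ x).
Proof.
  intros Hx n i.
  (* The two errors 1/2^(n+2) and 1/2^(n+i+2) must add up to strictly less than 1/2^n; with
     precision n + 1 in [near] the estimate would fail at i = 0. *)
  assert (L : forall q r, Le q r (pow2 i * 1 + 1) (n + i + 2) -> Lt q r 1 n).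
  { intros q r H; apply Lt_unscale with (i + 2).
    replace (n + (i + 2)) with (n + i + 2) by ring; apply Le_Lt with (1 := H).
    rewrite pow2_add, pow2_2; apply le_lt_trans with (2 * pow2 i).
    - refine (le_eq (le_add2 (le_refl (pow2 i)) (pow2_ge_1 i)) _ _); ring.
    - refine (lt_eq (lt_mul _ _ (2 * pow2 i) _ (lt_succ 1)) _ _); [|ring|ring].
      apply mul_pos; [apply two_pos | apply pow2_pos]. }
  destruct (normal_form_near n Hx) as [K HK], (normal_form_near (n + i) Hx) as [K' HK'].
  split; apply L, Le_archimedean with (K + K'); intros m;
    destruct (HK (i + m)) as [H1 H2], (HK' m) as [H3 H4];
    replace (n + 2 + (i + m)) with (n + i + 2 + m) in H1, H2 by ring.
  - apply (Le_weaken (Le_trans H1 H4)); right; rewrite pow2_add; ring.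
  - apply (Le_weaken (Le_trans H3 H2)); right; rewrite pow2_add; ring.
Qed.

Lemma normal_form_unit x : unit_interval x -> unit_interval (F ⋅ x).
Proof.
  intros [Hx [H0 H1]]; pose proof (normal_form_real Hx) as HFx.
  pose proof (normal_form_req Hx) as Hr.
  split; [exact HFx|]; split.
  - apply rle_trans with x; trivial; [apply isreal_const, rational_0|].
    intros n; apply Hr.
  - apply rle_trans with x; trivial; [apply isreal_const, rational_5|].
    intros n; apply Hr.
Qed.

(** * Finite enumerations of reals coded in Baire space *)

Context (Y : dom M ty2)
  (Hresp : forall x y, unit_interval x -> unit_interval y -> req x y -> Y ⋅ x = Y ⋅ y)
  (Hinj : forall x y, unit_interval x -> unit_interval y -> Y ⋅ x = Y ⋅ y -> req x y)
  (Hsurj : forall i, exists x, unit_interval x /\ Y ⋅ x = i).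

Definition inverse_image (i : N) (x : Seq) : Prop :=
  unit_interval x /\ F ⋅ x = x /\ Y ⋅ x = i.

(** A normal form is a fixed point of [F], since it equals the real it comes from and [F] depends on
    the value only. *)
Lemma inverse_image_exists i : exists x, inverse_image i x.
Proof.
  destruct (Hsurj i) as [x [Hx Hi]]; exists (F ⋅ x).
  pose proof (normal_form_unit Hx) as HFx.
  pose proof (normal_form_req (proj1 Hx)) as Hr.
  split; [exact HFx|]; split.
  - symmetry; apply normal_form_unique; trivial; [apply Hx | apply HFx].
  - rewrite <- Hi; symmetry; apply Hresp; trivial.
Qed.

Lemma inverse_image_unique i x y : inverse_image i x -> inverse_image i y -> x = y.
Proof.
  intros (Hx & Fx & Yx) (Hy & Fy & Yy); rewrite <- Fx, <- Fy.
  apply normal_form_unique; [apply Hx | apply Hy |].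
  apply Hinj; trivial; rewrite Yx, Yy; trivial.
Qed.

Lemma dec_inverse_image c f g : rep c Nat f -> rep c ty1 g ->
  dec c (fun e => inverse_image (f e) (g e)).
Proof.
  intros Hf Hg.
  assert (D : dec [ty1; Nat] (fun e => inverse_image (snd (fst e)) (snd e))).
  { unfold inverse_image; apply dec_and; [apply dec_unit_interval; rep | dec]. }
  exact (@dec_comp c [ty1; Nat] _ (fun e => (tt, f e, g e)) D (conj (conj I Hf) Hg)).
Qed.

(** Injective but not surjective, and free of division; the entries at other positions are fixed to
    0 in [enumeration]. *)
Definition pair (i j : N) : N := (i + j) * (i + j) + i.

Lemma pair_inj i j i' j' : pair i j = pair i' j' -> i = i' /\ j = j'.
Proof.
  assert (L : forall i j i' j', pair i j = pair i' j' -> i' + j' <= i + j).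
  { unfold pair; clear i j i' j'; intros i j i' j' H.
    destruct (le_or_lt (i' + j') (i + j)) as [C | C]; trivial; exfalso.
    apply lt_iff in C; destruct C as [d C].
    apply (lt_irrefl ((i + j) * (i + j) + i)); rewrite H at 2; rewrite C.
    apply lt_iff; exists (i + j + j + 2 * d * (i + j) + d * d + 2 * d + i'); ring. }
  intros H; assert (Hs : i + j = i' + j')
    by (apply le_antisym; apply L; [symmetry|]; exact H).
  unfold pair in H; rewrite Hs in H.
  assert (Hi : i = i').
  { apply add_cancel with ((i' + j') * (i' + j')); rewrite !(addC _ ((i' + j') * _)); exact H. }
  split; trivial; subst i'; apply add_cancel with i; rewrite !(addC _ i); exact Hs.
Qed.

Definition component (w : Seq) (i : N) : Seq := lam (fun j : N => w ⋅ (pair i j + 1)).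

Lemma component_eq w i j : component w i ⋅ j = w ⋅ (pair i j + 1).
Proof.
  apply lam_beta with (g := fun j => w ⋅ (pair i j + 1)); unfold pair; rep.
Qed.

(* [w] codes the enumeration of the normal forms of [Y^-1(0), ..., Y^-1(w 0)]. *)
Definition enumeration (w : Seq) : Prop :=
  (forall i, i <= w ⋅ 0 -> inverse_image i (component w i))
  /\ (forall k, (forall i j, i <= w ⋅ 0 -> k <> pair i j) -> w ⋅ (k + 1) = 0).

Ltac dec_enum := unfold pair; repeat first [apply dec_inverse_image | dec_step].

Lemma dec_enumeration c f : rep c ty1 f -> dec c (fun e => enumeration (f e)).
Proof. intros Hf; apply dec_elim; trivial; unfold enumeration, component; dec_enum. Qed.

(** The zero clause settles the entries outside the components, so the codes agree as functions;
    equality in Baire space is what the order is tested against. *)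
Lemma enumeration_unique u v : enumeration u -> enumeration v -> u ⋅ 0 = v ⋅ 0 -> u = v.
Proof.
  intros [Hu1 Hu2] [Hv1 Hv2] H0; apply Mext; intros k.
  destruct (zero_or_succ k) as [-> | E]; trivial; rewrite E; set (k' := pred k).
  destruct (classic (exists i j, i <= u ⋅ 0 /\ k' = pair i j)) as [(i & j & Hi & ->) | H].
  - rewrite <- !component_eq; f_equal; apply inverse_image_unique with i; auto.
    apply Hv1; rewrite <- H0; trivial.
  - rewrite Hu2, Hv2; trivial; intros i j Hi Ek; apply H; exists i, j; split; trivial.
    rewrite H0; trivial.
Qed.

(** Neither [w ⋅ 0] nor the entries outside the components are constrained, so the induction step
    only has to overwrite one component. *)
Definition partial_enumeration (n : N) (w : Seq) : Prop :=
  forall i, i <= n -> inverse_image i (component w i).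

(** No inverse of [pair] is computed: the new entries are chosen from the decidable graph of the
    update. *)
Lemma component_update (w x : Seq) n : exists w', component w' n = x
  /\ forall i, i <> n -> component w' i = component w i.
Proof.
  destruct (@choice_nat (fun k d => (forall j, k = pair n j -> d = x ⋅ j)
    /\ ((forall j, k <> pair n j) -> d = w ⋅ (k + 1)))) as [h Hh].
  - dec_enum.
  - intros k; destruct (classic (exists j, k = pair n j)) as [[j ->] | H].
    + exists (x ⋅ j); split; [|intros C; elim (C j); trivial].
      intros j' E; apply pair_inj in E; destruct E as [_ ->]; trivial.
    + exists (w ⋅ (k + 1)); split; trivial; intros j E; elim H; exists j; trivial.
  - exists (cons_seq 0 h); split; [|intros i Hi]; apply Mext; intros j;
      rewrite !component_eq, cons_seq_S.
    + apply (proj1 (Hh _)); trivial.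
    + apply (proj2 (Hh _)); intros j' E; apply pair_inj in E; tauto.
Qed.

(** For fixed [w] the condition quantifies over numbers only, so it has a characteristic functional
    [Z], and what remains is the formula shape of [ind1_axiom]. *)
Lemma partial_enumeration_exists n : exists w, partial_enumeration n w.
Proof.
  destruct (@fun_of_rep2 _ _ _ (fun w n => ite (partial_enumeration n w) 0 1)) as [Z HZ].
  { apply rep_ite; [|rep|rep]; unfold partial_enumeration, component; dec_enum. }
  assert (E : forall w n, Z ⋅ w ⋅ n = 0 <-> partial_enumeration n w).
  { intros w m; rewrite HZ; split; [|apply ite_true].
    intros H; apply NNPP; intros C; rewrite ite_false in H by trivial.
    elim (lt_irrefl 0); rewrite <- H at 2; apply lt_0_1. }
  destruct (@ind1_axiom Z) with (n := n) as [w Hw]; [| |exists w; apply E, Hw].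
  - destruct (inverse_image_exists 0) as [x Hx].
    destruct (component_update rzero x 0) as (w & H & _).
    exists w; apply E; intros i Hi; apply le_0_eq in Hi; rewrite Hi, H; exact Hx.
  - intros m [w Hw]; apply E in Hw.
    destruct (inverse_image_exists (m + 1)) as [x Hx].
    destruct (component_update w x (m + 1)) as (w' & H & H').
    exists w'; apply E; intros i Hi.
    destruct (classic (i = m + 1)) as [-> | Hn]; [rewrite H; exact Hx|].
    rewrite H' by trivial; apply Hw; destruct Hi as [Hi | Hi]; [|contradiction].
    apply le_lt_succ, Hi.
Qed.

(** Infinity of the order asks for one sequence of elements, and they cannot be chosen separately;
    all of them are cut out of a single partial enumeration up to [n]. *)
Lemma enumerations_below n : exists W : dom M (Nat ⇒ ty1),
  forall i, i <= n -> enumeration (W ⋅ i) /\ W ⋅ i ⋅ 0 = i.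
Proof.
  destruct (partial_enumeration_exists n) as [w Hw].
  destruct (@fun_of_rep2 _ _ _
    (fun i k => ite (exists i' j, i' <= i /\ k = pair i' j) (w ⋅ (k + 1)) 0)) as [V HV].
  { apply rep_ite; [dec_enum | rep | rep]. }
  destruct (@fun_of_rep1 _ _ (fun i => cons_seq i (V ⋅ i))) as [W HW];
    [unfold cons_seq; rep|].
  exists W; intros i Hi; rewrite HW.
  split; [|apply cons_seq_0]; split; rewrite cons_seq_0.
  - intros i' Hi'; replace (component _ i') with (component w i').
    + apply Hw, le_trans with i; trivial.
    + apply Mext; intros j; rewrite !component_eq, cons_seq_S, HV, ite_true; trivial.
      exists i', j; auto.
  - intros k Hk; rewrite cons_seq_S, HV, ite_false; trivial.
    intros (i' & j & Hi' & E); exact (Hk _ _ Hi' E).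
Qed.

(** * The linear order *)

Lemma no_surjective_sequence (x : dom M (Nat ⇒ ty1)) :
  ~ forall n, inverse_image n (x ⋅ n).
Proof.
  intros Hx.
  pose (mid := fun n a => rat (4 * a + 2) (pred (pow4 (n + 1)))).
  destruct (@fun_of_rep2 _ _ _
    (fun n a => ite (Le (x ⋅ n ⋅ (n + 2 + (n + 2))) (mid n a) 0 0) 1 0)) as [G HG].
  { unfold mid, rat, tri, pred, pow4, pow2.
    apply rep_ite; [apply dec_Le|rep|rep]; rep. }
  assert (G1 : forall n a, G ⋅ n ⋅ a <= 1).
  { intros n a; rewrite HG; unfold ite; destruct excluded_middle_informative;
      [apply le_refl | apply le_0]. }
  pose proof (digits_real_unit G G1) as Hy.
  (* The diagonal real would have to equal the entry whose index is its own value under [Y], and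
     digit [n] separates the two. *)
  destruct (Hx (Y ⋅ digits_real G)) as (Hu & _ & HYx).
  set (n := Y ⋅ digits_real G) in *.
  apply (@digits_real_avoids G G1 n (x ⋅ n)); [|apply Hinj; trivial].
  rewrite HG; fold (mid n (digits G n)).
  destruct (classic (Le (x ⋅ n ⋅ (n + 2 + (n + 2))) (mid n (digits G n)) 0 0)) as [H | H].
  - left; rewrite ite_true; auto.
  - right; rewrite ite_false by trivial; split; trivial.
    destruct (@Le_or (x ⋅ n ⋅ (n + 2 + (n + 2))) (mid n (digits G n))) as [C | C];
      trivial; [apply isreal_rational, Hu | | contradiction].
    eexists _, _, _; apply codes_rat_code.
Qed.

Lemma one_neq_zero : 1 <> 0.
Proof. intros H; apply (lt_irrefl 0); rewrite <- H at 2; apply lt_0_1. Qed.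

Lemma ite_eq_1 P : ite P 1 0 = 1 <-> P.
Proof.
  split; [|apply ite_true].
  intros H; apply NNPP; intros C; rewrite ite_false in H by trivial.
  elim one_neq_zero; symmetry; exact H.
Qed.

Lemma ADS0_refuted : ~ sat (M := M) no_env (ADS0_for baire).
Proof.
  intros HADS.
  destruct (@fun_of_rep1 _ _ (fun w => ite (enumeration w) 1 0)) as [X HX].
  { apply rep_ite; [apply dec_enumeration; rep | rep | rep]. }
  destruct (@fun_of_rep2 _ _ _ (fun u v : Seq => ite (u ⋅ 0 <= v ⋅ 0) 1 0)) as [L HL].
  { apply rep_ite; [dec | rep | rep]. }
  destruct (@fun_of_rep1 _ _ (fun w : Seq => w ⋅ 0)) as [C HC]; [rep|].
  assert (Xmem : forall w, X ⋅ w = 1 <-> enumeration w)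
    by (intros; rewrite HX; apply ite_eq_1).
  assert (Lle : forall u v, L ⋅ u ⋅ v = 1 <-> u ⋅ 0 <= v ⋅ 0)
    by (intros; rewrite HL; apply ite_eq_1).
  specialize (HADS X L).
  assert (Hs : exists s : dom M (Nat ⇒ ty1),
    (forall n, enumeration (s ⋅ n))
    /\ ((forall n, s ⋅ n ⋅ 0 < s ⋅ (n + 1) ⋅ 0) \/ (forall n, s ⋅ (n + 1) ⋅ 0 < s ⋅ n ⋅ 0))).
  (* The premise is what [mem baire] unfolds to; every sequence is a point. *)
  { assert (Xm : forall w, (False -> False) /\ X ⋅ w = i_one M -> enumeration w)
      by (intros w [_ Hw]; apply Xmem, Hw).
    assert (bit : forall P, ite P 1 0 = 0 \/ ite P 1 0 = 1).
    { intros P; unfold ite; destruct excluded_middle_informative; auto. }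
    assert (Hlt : forall u v, enumeration u -> enumeration v -> L ⋅ u ⋅ v = 1 ->
      ~ (forall n, u ⋅ n = v ⋅ n) -> u ⋅ 0 < v ⋅ 0).
    { intros u v Hu Hv H Hne; apply Lle in H; destruct H as [H | H]; trivial.
      elim Hne; rewrite (enumeration_unique Hu Hv H); trivial. }
    cbn in HADS; destruct HADS as [s [Hs1 Hs2]].
    - split; [split|split; [split|split; [|split; [|split]]]].
      + intros u v _ _ H; rewrite (@Mext _ _ u v H); trivial.
      + intros w _; rewrite HX; apply bit.
      + intros u v _ _; rewrite HL; apply bit.
      + intros u u' v v' _ _ _ _ H H'.
        rewrite (@Mext _ _ u u' H), (@Mext _ _ v v' H'); trivial.
      + intros w _; apply Lle, le_refl.
      + intros u v Hu Hv H H' k; apply Lle in H; apply Lle in H'.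
        rewrite (enumeration_unique (Xm _ Hu) (Xm _ Hv) (le_antisym H H')); trivial.
      + intros u v w _ _ _ H H'; apply Lle in H; apply Lle in H'.
        apply Lle, le_trans with (v ⋅ 0); trivial.
      + intros u v _ _; destruct (le_total (u ⋅ 0) (v ⋅ 0)); [left | right]; apply Lle; trivial.
    - exists C; split.
      + intros u v _ _ H; rewrite (@Mext _ _ u v H); trivial.
      + intros u v Hu Hv H k; rewrite !HC in H.
        rewrite (enumeration_unique (Xm _ Hu) (Xm _ Hv) H); trivial.
    - intros n; destruct (enumerations_below n) as [W HW]; exists W; split.
      + intros i Hi; split; trivial; apply Xmem, HW, Hi.
      + intros i j Hi Hj Hij E; apply Hij.
        rewrite <- (proj2 (HW i Hi)), <- (proj2 (HW j Hj)); apply E.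
    - exists s; split; [intros n; apply Xm, Hs1|].
      destruct Hs2 as [Hs2 | Hs2]; [left | right]; intros n;
        (apply Hlt; [apply Xm, Hs1 | apply Xm, Hs1 | exact (proj1 (Hs2 n)) | exact (proj2 (Hs2 n))]). }
  destruct Hs as [s [Hs [H | H]]].
  (* Hence [s ⋅ n] is long enough to have component [n], and these components form a sequence of all
     preimages. *)
  - assert (Hn : forall n, n <= s ⋅ n ⋅ 0).
    { apply (@nat_ind (fun n => n <= s ⋅ n ⋅ 0)); [dec | apply le_0 |].
      intros n Hn; apply lt_le_succ, le_lt_trans with (s ⋅ n ⋅ 0); trivial. }
    destruct (@fun_of_rep1 _ _ (fun n => component (s ⋅ n) n)) as [x Hx];
      [unfold component, pair; rep|].
    apply (@no_surjective_sequence x); intros n; rewrite Hx; apply Hs, Hn.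
  (* The numbers of the structure need not be well founded, so descent is refuted by an internal
     induction, evaluated one step beyond the initial length. *)
  - assert (Hn : forall n, s ⋅ n ⋅ 0 + n <= s ⋅ 0 ⋅ 0).
    { apply (@nat_ind (fun n => s ⋅ n ⋅ 0 + n <= s ⋅ 0 ⋅ 0)); [dec | right; ring |].
      intros n Hn; eapply le_trans; [|exact Hn].
      refine (le_eq (le_add n (proj1 (lt_le_succ _ _) (H n))) _ _); ring. }
    refine (lt_not_le _ (Hn (s ⋅ 0 ⋅ 0 + 1))); apply lt_iff.
    exists (s ⋅ (s ⋅ 0 ⋅ 0 + 1) ⋅ 0); ring.
Qed.

End NormalForm.

End Quantifier.

(** * The implication in a structure and its derivability *)

Lemma ADS0_NBI : sat (M := M) no_env ADS0 -> sat (M := M) no_env NBI.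
Proof.
  intros [_ HADS] Y Hresp; apply NNPP; intros HN.
  change (forall x y, unit_interval x -> unit_interval y -> req x y -> Y ⋅ x = Y ⋅ y)
    in Hresp.
  assert (HN' : ~ ((exists x y, unit_interval x /\ unit_interval y
      /\ ~ req x y /\ Y ⋅ x = Y ⋅ y)
    \/ (exists n, forall x, unit_interval x -> ~ Y ⋅ x = n))) by exact HN.
  assert (Hinj : forall x y, unit_interval x -> unit_interval y ->
    Y ⋅ x = Y ⋅ y -> req x y).
  { intros x y Hx Hy E; apply NNPP; intros H; apply HN'; left; exists x, y; auto. }
  assert (Hsurj : forall i, exists x, unit_interval x /\ Y ⋅ x = i).
  { intros i; apply NNPP; intros H; apply HN'; right; exists i.
    intros x Hx E; apply H; exists x; auto. }
  pose proof (numerical_quantifier Y Hresp Hinj) as E2.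
  destruct (normal_form_exists E2) as [F HF].
  exact (ADS0_refuted E2 F HF Y Hresp Hinj Hsurj HADS).
Qed.

End Model.

Theorem theorem3p32 : RCA0w ⊕ IND1 ⊢ ADS0 → NBI.
Proof.
  apply completeness.
  - apply stable_add_axiom; [apply stable_RCA0w | reflexivity].
  - intros V ρ τ; left; apply ax_ext.
  - intros M Mext Max; exact (ADS0_NBI Mext Max).
Qed.
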